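(* Let $X(\mathbb D)$ be a Banach space of analytic functions on $\mathbb D$ containing the constant functions and such that: (I) the topology induced by its norm is finer than the compact-open topology; (IV) if $f\in X(\mathbb D)$ has a zero at $z_0\in\mathbb D$, then $\frac{f(z)}{z-z_0}\in X(\mathbb D)$; and $M(X(\mathbb D))=H^\infty(\mathbb D)$ (so that, in particular, the following condition also holds with $Y(\mathbb D)=X(\mathbb D)$: (III) $H^\infty(\mathbb D)\subset M(Y(\mathbb D))$). Let $u\in M(X(\mathbb D))$ and let $M_u:X(\mathbb D)\to X(\mathbb D)$, $M_uf=uf$. Then $$\sigma_e(M_u)=\bigcap_{0<r<1}\overline{u(\mathbb D\setminus r\mathbb D)}.$$
   Context: $\mathbb D$ is the open unit disk, $\mathcal H(\mathbb D)$ the space of analytic functions on it, $H^\infty(\mathbb D)$ the bounded ones. $M(X(\mathbb D))=\{u\in\mathcal H(\mathbb D):uf\in X(\mathbb D)\ \forall f\in X(\mathbb D)\}$; under (I), each such $u$ induces a bounded operator $M_u$ on $X(\mathbb D)$. A bounded operator on a Banach space is Fredholm if it has closed range and finite-dimensional kernel and cokernel; $\sigma_e(T)=\{\lambda\in\mathbb C:T-\lambda I\text{ is not Fredholm}\}$. *)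

(* Defs.v *)
From HB Require Import structures.
From mathcomp Require Import all_boot all_order all_algebra.
From mathcomp Require Import complex.
From mathcomp Require Import all_classical all_reals all_analysis.

Set Implicit Arguments.
Unset Strict Implicit.
Unset Printing Implicit Defensive.

Import Order.TTheory GRing.Theory Num.Theory.
Import numFieldNormedType.Exports.

Local Open Scope classical_set_scope.
Local Open Scope ring_scope.

(* R[i] seen through the numClosedFieldType structure, from which its topology
   and its normed module structure over itself are inferred. *)
Definition C (R : realType) : numClosedFieldType := R[i].

Section Fredholm.
Context {K : numFieldType} {X : normedModType K}.
Implicit Types (V : set X) (T : {linear X -> X}).

Definition finite_dim V :=
  exists (n : nat) (e : 'I_n -> X), (forall i, V (e i)) /\
    forall x, V x -> exists c : 'I_n -> K, x = \sum_i c i *: e i.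

(* The classes of the e i span the quotient of X by the subspace V. *)
Definition finite_codim V :=
  exists (n : nat) (e : 'I_n -> X),
    forall x, exists c : 'I_n -> K, V (x - \sum_i c i *: e i).

Definition fredholm T :=
  [/\ continuous T, closed (range T), finite_dim [set x | T x = 0]
    & finite_codim (range T)].

Definition essential_spectrum T : set K :=
  [set lambda | ~ fredholm (T \- lambda \*: idfun)].

End Fredholm.

Section Disc.
Variable R : realType.

Definition disc : set (C R) := [set z | `|z| < 1].

Definition analytic (f : disc -> C R) :=
  forall z0 : disc, exists a : nat -> C R, \forall z \near z0,
    series (fun n => a n * (val z - val z0) ^+ n) @ \oo --> f z.

Definition Hinfty : set (disc -> C R) :=
  [set u | analytic u /\ bounded_fun u].

End Disc.

Arguments disc R : clear implicits.
Arguments Hinfty R : clear implicits.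

(* A Banach space of analytic functions on the disc is given by an abstract
   Banach space X together with the map ev sending an element of X to the
   function on the disc that it is. *)
Section FunctionSpace.
Context {R : realType} {X : completeNormedModType (C R)}.
Variable ev : {linear X -> (disc R -> C R)}.

Definition space_of_analytic_functions :=
  injective ev /\ forall f, analytic (ev f).

Definition contains_constants := forall c : C R, range ev (cst c).

Definition finer_than_compact_open :=
  continuous (ev : X -> {compact-open, disc R -> C R}).

(* The value of f(z) / (z - z0) at z0 is left out: it is determined by the
   analyticity of ev g. *)
Definition division_property :=
  forall (f : X) (z0 : disc R), ev f z0 = 0 ->
    exists g : X, forall z : disc R, z != z0 ->
      ev g z = ev f z / (val z - val z0).

Definition multipliers : set (disc R -> C R) :=
  [set u | analytic u /\ forall f : X, range ev (u \* ev f)].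

Section MultiplicationOperator.
Hypothesis evX : space_of_analytic_functions.
Variables (u : disc R -> C R) (Mu : multipliers u).

Lemma mult_op_subproof (f : X) : exists g : X, ev g = u \* ev f.
Proof. by have [g _ <-] := Mu.2 f; exists g. Qed.

Definition mult_op (f : X) : X := projT1 (cid (mult_op_subproof f)).

Lemma mult_opE (f : X) : ev (mult_op f) = u \* ev f.
Proof. by rewrite /mult_op; case: cid. Qed.

Lemma mult_op_is_linear : linear mult_op.
Proof.
move=> a f g; apply: evX.1; rewrite linearP !mult_opE linearP.
by apply/funext => z /=; rewrite !fctE mulrDr; congr (_ + _); rewrite mulrCA.
Qed.

Definition mult_operator : {linear X -> X} :=
  HB.pack mult_op (GRing.isLinear.Build _ _ _ _ mult_op mult_op_is_linear).

End MultiplicationOperator.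

End FunctionSpace.

(* Main.v *)
(* Put v = u - lambda. If v is bounded below near the circle, it has finitely many
   zeros; splitting them off by (IV) leaves a bounded analytic function that is
   bounded below, whose reciprocal is a multiplier. Hence the range of M_v is that
   of a polynomial, and each linear factor keeps the range closed and of finite
   codimension, because f |-> (f - f(a)) / (z - a) is bounded by the closed graph
   theorem.

   If v is not bounded below near the circle, choose z_n -> zeta on the circle with
   v(z_n) -> 0. Were v X of finite codimension in X, then among sufficiently many
   bounded functions psi_j a nontrivial combination psi would satisfy psi X <= v X,
   so that psi = v q with q a multiplier, hence bounded, and psi(z_n) -> 0. Sums of
   rational bumps concentrated at a very sparse subsequence of (z_n) provide
   functions psi_j no nontrivial combination of which tends to 0 along it. Neither
   the closedness of the range nor the kernel matters in this half. *)
From HB Require Import structures.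
Require Import Defs.
From mathcomp Require Import all_boot all_order all_algebra.
From mathcomp Require Import complex.
From mathcomp Require Import all_classical all_reals all_analysis.
From mathcomp Require Import ring lra.
Import Order.TTheory GRing.Theory Num.Theory.
Import numFieldNormedType.Exports.
Local Open Scope classical_set_scope.
Local Open Scope ring_scope.
Set Implicit Arguments.
Unset Strict Implicit.
Unset Printing Implicit Defensive.

(** * Real-valued norms and geometric Cauchy sequences *)

(** Analyticity is given by local power series, so a reciprocal [1 / v] must be expanded at every
    point before it counts as an element of [Hinfty R], hence as a multiplier. The expansion is
    found inside [X], where the shift at a point is a bounded operator and its iterates grow at most
    geometrically. Boundedness comes from condition (I), which makes point evaluations continuous
    and so closes the graph. In the other half, interpolation by bounded functions is replaced by
    explicit bumps in the variable [w = 1 - z / zeta] of the right half-plane: only a lower bound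
    along a sequence is wanted, not prescribed values. When [|w|] shrinks by a factor of at least
    100 at each step, the bump belonging to a point has modulus at least 1/6 there, and all the
    others together at most 6/100. The equality of multipliers with [Hinfty R] is used in both
    directions: the bounded functions [1 / v] and [psi j] act on [X], and the quotient [q] is
    bounded. *)

(* [_%:C%C] retyped in [C R], so that the order and norm inferred on its values
   are those of [C R] rather than those of [R[i]]. *)
Definition cplx {R : realType} (r : R) : C R := r%:C%C.

Section RealEmbedding.
Context {R : realType}.
Implicit Types r s : R.

Lemma cplx_inj : injective (@cplx R). Proof. exact: complexI. Qed.

Lemma cplx0 : cplx (0 : R) = 0. Proof. by []. Qed.

Lemma cplx1 : cplx (1 : R) = 1. Proof. by []. Qed.

Lemma cplxD r s : cplx (r + s) = cplx r + cplx s. Proof. exact: rmorphD. Qed.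

Lemma cplxN r : cplx (- r) = - cplx r. Proof. exact: rmorphN. Qed.

Lemma cplxM r s : cplx (r * s) = cplx r * cplx s. Proof. exact: rmorphM. Qed.

Lemma cplxV r : cplx r^-1 = (cplx r)^-1. Proof. exact: fmorphV. Qed.

Lemma cplxX r n : cplx (r ^+ n) = cplx r ^+ n. Proof. exact: rmorphXn. Qed.

Lemma cplx_nat n : cplx (n%:R : R) = n%:R. Proof. exact: rmorph_nat. Qed.

Lemma cplx_le r s : (cplx r <= cplx s) = (r <= s). Proof. exact: lecR. Qed.

Lemma cplx_lt r s : (cplx r < cplx s) = (r < s). Proof. exact: ltcR. Qed.

Lemma cplx_ge0 r : (0 <= cplx r) = (0 <= r). Proof. exact: lecR. Qed.

Lemma cplx_gt0 r : (0 < cplx r) = (0 < r). Proof. exact: ltcR. Qed.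

Lemma cplx_Re (z : C R) : 0 <= z -> z = cplx (complex.Re z).
Proof. by move=> z0; apply/esym/RRe_real; rewrite realE z0. Qed.

End RealEmbedding.

Definition rnorm {R : realType} {V : normedModType (C R)} (x : V) : R :=
  complex.Re `|x|.

Section RealNorm.
Context {R : realType} {V : normedModType (C R)}.
Implicit Types (x y : V) (a b : C R).

Lemma rnormE x : `|x| = cplx (rnorm x).
Proof. exact/cplx_Re/normr_ge0. Qed.

Lemma rnorm_ge0 x : 0 <= rnorm x.
Proof. by rewrite -cplx_ge0 -rnormE normr_ge0. Qed.

Lemma rnorm0 : rnorm (0 : V) = 0.
Proof. by rewrite /rnorm normr0. Qed.

Lemma rnorm_eq0 x : (rnorm x == 0) = (x == 0).
Proof. by rewrite -[RHS]normr_eq0 rnormE -cplx0 (inj_eq cplx_inj). Qed.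

Lemma rnorm_gt0 x : (0 < rnorm x) = (x != 0).
Proof. by rewrite lt_neqAle rnorm_ge0 andbT eq_sym rnorm_eq0. Qed.

Lemma rnormN x : rnorm (- x) = rnorm x.
Proof. by rewrite /rnorm normrN. Qed.

Lemma rnormB x y : rnorm (x - y) = rnorm (y - x).
Proof. by rewrite /rnorm distrC. Qed.

Lemma rnormD x y : rnorm (x + y) <= rnorm x + rnorm y.
Proof. by rewrite -cplx_le cplxD -!rnormE ler_normD. Qed.

Lemma rnormBD y x z : rnorm (x - z) <= rnorm (x - y) + rnorm (y - z).
Proof. by rewrite (le_trans _ (rnormD _ _))// addrA subrK. Qed.

Lemma rnorm_dist x y : rnorm x - rnorm y <= rnorm (x - y).
Proof. by have := rnormD (x - y) y; rewrite subrK lerBlDr. Qed.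

Lemma rnormZ a x : rnorm (a *: x) = rnorm a * rnorm x.
Proof.
by apply: cplx_inj; rewrite -rnormE normrZ rnormE cplxM; congr (_ * _).
Qed.

Lemma rnorm_sum (I : Type) (s : seq I) (P : pred I) (F : I -> V) :
  rnorm (\sum_(i <- s | P i) F i) <= \sum_(i <- s | P i) rnorm (F i).
Proof.
elim/big_rec2: _ => [|i x y _ xy]; first by rewrite rnorm0.
by rewrite (le_trans (rnormD _ _))// lerD.
Qed.

Lemma nbhs_rnormP x (A : set V) :
  nbhs x A <-> exists2 e : R, 0 < e & forall y, rnorm (y - x) < e -> A y.
Proof.
split=> [/nbhs_normP[e /= e0 eA]|[e e0 eA]].
  exists (complex.Re e); first by rewrite -cplx_gt0 -cplx_Re// ltW.
  by move=> y yx; apply: eA; rewrite /ball_/= (cplx_Re (ltW e0)) distrC rnormE cplx_lt.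
apply/nbhs_normP; exists (cplx e); first by rewrite /= cplx_gt0.
by move=> y; rewrite /ball_/= distrC rnormE cplx_lt; exact: eA.
Qed.

Lemma cvg_rnormP (u : nat -> V) x :
  u @ \oo --> x <-> forall e : R, 0 < e ->
    exists N, forall n, (N <= n)%N -> rnorm (u n - x) < e.
Proof.
split=> [ux e e0|ux A /nbhs_rnormP[e e0 eA]].
  have : nbhs x [set y | rnorm (y - x) < e] by apply/nbhs_rnormP; exists e.
  by move=> /ux[N _ Nu]; exists N => n Nn; exact: Nu.
by have [N Nu] := ux e e0; exists N => // n /= /Nu; exact: eA.
Qed.

End RealNorm.

Section ComplexModulus.
Context {R : realType}.
Implicit Types a b : C R.

Lemma rnormM a b : rnorm (a * b) = rnorm a * rnorm b.
Proof. by apply: cplx_inj; rewrite cplxM -!rnormE normrM. Qed.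

Lemma rnorm1 : rnorm (1 : C R) = 1.
Proof. by rewrite /rnorm normr1. Qed.

Lemma rnormX a n : rnorm (a ^+ n) = rnorm a ^+ n.
Proof. by apply: cplx_inj; rewrite cplxX -!rnormE normrX. Qed.

Lemma rnormV a : rnorm a^-1 = (rnorm a)^-1.
Proof. by apply: cplx_inj; rewrite cplxV -!rnormE normfV. Qed.

Lemma rnorm_cplx (r : R) : rnorm (cplx r) = `|r|.
Proof. by rewrite /rnorm normc_def /= expr0n /= addr0 sqrtr_sqr. Qed.

Lemma rnorm_i : rnorm ('i%C : C R) = 1.
Proof. by rewrite /rnorm normc_def /= expr0n expr1n add0r sqrtr1. Qed.

Lemma Re_le_rnorm a : `|complex.Re a| <= rnorm a.
Proof. by rewrite -cplx_le -rnormE; exact: normc_ge_Re. Qed.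

Lemma Im_le_rnorm a : `|complex.Im a| <= rnorm a.
Proof.
rewrite /rnorm normc_def /= -[leLHS]sqrtr_sqr.
by rewrite ler_sqrt ?addr_ge0 ?sqr_ge0// lerDr sqr_ge0.
Qed.

End ComplexModulus.

Lemma near_discP (R : realType) (a : disc R) (P : disc R -> Prop) :
  (\forall z \near a, P z) <->
  exists2 e : R, 0 < e & forall z : disc R, rnorm (val z - val a) < e -> P z.
Proof.
split.
  move=> [_ [[B Bo <-] /= Ba BP]].
  have : nbhs (val a) B by apply: open_nbhs_nbhs.
  by move=> /nbhs_rnormP[e e0 eB]; exists e => // z za; apply: BP; exact: eB.
move=> [e e0 eP].
have ae : nbhs (val a) [set y : C R | rnorm (y - val a) < e].
  by apply/nbhs_rnormP; exists e.
apply: (@filterS _ (nbhs a) _ (val @^-1` [set y : C R | rnorm (y - val a) < e])).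
  by move=> z; exact: eP.
exact: (@initial_continuous (disc R) (C R) val a _ ae).
Qed.

(* The first hypothesis stands for an archimedean axiom, which [numFieldType] lacks
   and which [C R] does not provide as a structure. *)
Lemma geometric_cauchy (K : numFieldType) (V : completeNormedModType K)
    (u : nat -> V) (c : K) :
  (forall e : K, 0 < e -> exists n, c * 2 / 2 ^+ n < e) ->
  (forall n, `|u n.+1 - u n| <= c / 2 ^+ n) ->
  exists l : V, forall n, `|l - u n| <= c * 2 / 2 ^+ n.
Proof.
move=> archi uc.
have c0 : 0 <= c.
  by have := uc 0%N; rewrite expr0 divr1; exact: le_trans.
have inv2 n : 0 < 2 ^- n :> K by rewrite invr_gt0 exprn_gt0.
(* The factor [1 - 2 ^- k] lets the induction close; the plain bound would not reproduce itself. *)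
have far n k : `|u (n + k)%N - u n| <= c * 2 / 2 ^+ n * (1 - 2 ^- k).
  elim: k => [|k IH].
    by rewrite addn0 subrr normr0 expr0 invr1 subrr mulr0.
  rewrite -(subrK (u (n + k)%N) (u _)) -addrA (le_trans (ler_normD _ _))//.
  rewrite addnS (le_trans (lerD (uc _) IH))//.
  rewrite exprD exprS !invfM.
  set p := 2 ^- n; set q := 2 ^- k.
  rewrite le_eqVlt; apply/orP; left; apply/eqP.
  by field.
have far' n k : (n <= k)%N -> `|u k - u n| <= c * 2 / 2 ^+ n.
  move=> /subnKC <-; apply: le_trans (far _ _) _.
  apply: ler_piMr; last by rewrite gerBl (ltW (inv2 _)).
  by rewrite !mulr_ge0// (ltW (inv2 _)).
have ucvg : cvgn u.
  apply: cauchy_cvg; apply: cauchy_exP => e e0.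
  have [n ne] := archi e e0.
  exists (u n), n => // k /= nk; rewrite -ball_normE /ball_/= distrC.
  exact: le_lt_trans (far' _ _ nk) ne.
exists (limn u) => n.
apply/ler_addgt0Pr => e e0.
have /cvgrPdist_lt/(_ e e0)[m _ mu] := ucvg.
have mn : `|limn u - u (maxn m n)| < e by apply: mu; exact: leq_maxl.
rewrite -(subrK (u (maxn m n)) (limn u)) -addrA (le_trans (ler_normD _ _))//.
by rewrite [leRHS]addrC (lerD (ltW mn))// far'// leq_maxr.
Qed.

Lemma geometric_lt (R : realType) (c e : R) :
  0 < e -> exists n, c / 2 ^+ n < e.
Proof.
move=> e0; have [n cn] : exists n, c / e < 2 ^+ n.
  exists (Num.truncn (c / e)).+1; apply: lt_trans (truncnS_gt _) _.
  by rewrite -natrX ltr_nat ltn_expl.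
by exists n; rewrite ltr_pdivrMr ?exprn_gt0// mulrC -ltr_pdivrMr.
Qed.

Lemma rnorm_geometric_cauchy (R : realType) (V : completeNormedModType (C R))
    (u : nat -> V) (c : R) :
  (forall n, rnorm (u n.+1 - u n) <= c / 2 ^+ n) ->
  exists l : V, forall n, rnorm (l - u n) <= c * 2 / 2 ^+ n.
Proof.
have toC (d : R) n : cplx (d / 2 ^+ n) = cplx d / 2 ^+ n.
  by rewrite cplxM cplxV cplxX cplx_nat.
move=> uc; have [e e0|n|l lu] := @geometric_cauchy _ V u (cplx c).
- have [n ne] : exists n, c * 2 / 2 ^+ n < complex.Re e.
    by apply: geometric_lt; rewrite -cplx_gt0 -cplx_Re// ltW.
  by exists n; rewrite (cplx_Re (ltW e0)) -(cplx_nat 2) -cplxM cplx_nat -toC cplx_lt.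
- by rewrite -toC rnormE cplx_le.
by exists l => n; rewrite -cplx_le -rnormE toC cplxM cplx_nat; exact: lu.
Qed.

(** Real and imaginary parts converge separately, each with constant [c * 2]. *)
Lemma complex_geometric_cauchy (R : realType) (u : nat -> C R) (c : R) :
  (forall n, rnorm (u n.+1 - u n) <= c / 2 ^+ n) ->
  exists l : C R, forall n, rnorm (l - u n) <= c * 4 / 2 ^+ n.
Proof.
move=> uc.
have archi e : 0 < e -> exists n, c * 2 / 2 ^+ n < e by exact: geometric_lt.
have [n|p pu] := geometric_cauchy (V := R) (u := fun n => complex.Re (u n)) archi.
  rewrite (le_trans _ (uc n))// (le_trans _ (Re_le_rnorm _))//=.
  by case: (u n.+1) (u n) => [? ?] [].
have [n|q qu] := geometric_cauchy (V := R) (u := fun n => complex.Im (u n)) archi.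
  rewrite (le_trans _ (uc n))// (le_trans _ (Im_le_rnorm _))//=.
  by case: (u n.+1) (u n) => [? ?] [].
exists (p +i* q)%C => n.
rewrite (_ : _ - _ = cplx (p - complex.Re (u n)) +
    'i%C * cplx (q - complex.Im (u n)) :> C R).
  rewrite (le_trans (rnormD _ _))// rnormM !rnorm_cplx rnorm_i mul1r.
  have := lerD (pu n) (qu n); rewrite -mulrDl -mulrDr; congr (_ <= _ * _ / _).
  by rewrite -natrD.
case: (u n) => a b; rewrite /cplx/=; apply/eqP.
by rewrite eq_complex/= !(mul0r, mulr0, mul1r, addr0, add0r, subr0) !eqxx.
Qed.

(** Compactness of the square, as a near covering: the filter [F] on lists is generated by the lists
    containing a given one. Centres may lie anywhere in the square, so later gauges [e] are defined
    on the whole plane. *)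
Lemma closed_disc_cover (R : realType) (e : C R -> R) :
  (forall a, 0 < e a) ->
  exists s : seq (C R), forall z : C R, rnorm z <= 1 ->
    exists2 a, a \in s & rnorm (z - a) < e a.
Proof.
move=> e0.
pose pt (p : R * R) : C R := cplx p.1 + 'i%C * cplx p.2.
pose F : set_system (seq (C R)) :=
  [set P | exists s0 : seq (C R), forall s : seq (C R), {subset s0 <= s} -> P s].
have FF : Filter F.
  split; first by exists nil.
  - move=> P Q [s sP] [t tQ]; exists (s ++ t) => w sw; split.
      by apply: sP => x xs; apply: sw; rewrite mem_cat xs.
    by apply: tQ => x xs; apply: sw; rewrite mem_cat xs orbT.
  - by move=> P Q PQ [s sP]; exists s => t /sP /PQ.
pose P (s : seq (C R)) (p : R * R) :=
  exists2 a, a \in s & rnorm (pt p - a) < e a.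
have K : compact ([set` `[(-1 : R), 1]] `*` [set` `[(-1 : R), 1]]).
  by apply: compact_setX; exact: segment_compact.
have [|s sP] := (compact_near_coveringP _).1 K _ F P FF.
  move=> p _; have e2 : 0 < e (pt p) / 2 by rewrite divr_gt0.
  exists ([set q : R * R | `|p.1 - q.1| < e (pt p) / 2 /\ `|p.2 - q.2| < e (pt p) / 2],
          [set s : seq (C R) | pt p \in s]) => /=.
    split.
      have nb (x : R) : nbhs x [set y | `|x - y| < e (pt p) / 2].
        by apply/nbhs_ballP; exists (e (pt p) / 2).
      by exists ([set x | `|p.1 - x| < e (pt p) / 2],
                 [set x | `|p.2 - x| < e (pt p) / 2]).
    by exists [:: pt p] => s; apply; rewrite mem_head.
  move=> [q s] /= [[q1 q2] ps]; exists (pt p) => //.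
  rewrite (_ : _ - _ = cplx (q.1 - p.1) + 'i%C * cplx (q.2 - p.2)); last first.
    by rewrite /pt !cplxD !cplxN; ring.
  rewrite (le_lt_trans (rnormD _ _))// rnormM !rnorm_cplx rnorm_i mul1r.
  by rewrite (splitr (e _)) ltrD// distrC.
have sK := sP s (fun x xs => xs).
exists s => z z1.
pose p := (complex.Re z, complex.Im z).
have -> : z = pt p by exact: complexE.
apply: sK; split => /=.
  by rewrite in_itv /= -ler_norml (le_trans (Re_le_rnorm _)).
by rewrite in_itv /= -ler_norml (le_trans (Im_le_rnorm _)).
Qed.

(** * The closed graph theorem *)

Section ClosedGraph.
Context {R : realType} {X Y : completeNormedModType (C R)}.
Variable T : {linear X -> Y}.

(** Baire's argument: were no sublevel set of [rnorm (T z)] dense in a ball, nested balls avoiding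
    them one after another would shrink to a point outside all of them. *)
Lemma baire_linear_sublevel :
  exists (n : nat) (x0 : X) (rho : R), 0 < rho /\
    forall y, rnorm (y - x0) < rho -> forall e : R, 0 < e ->
      exists2 z, rnorm (z - y) < e & rnorm (T z) <= n%:R.
Proof.
apply: contrapT => noball.
have step (p : nat * (X * R)) : exists q : X * R, 0 < p.2.2 ->
    [/\ rnorm (q.1 - p.2.1) <= p.2.2 / 4, 0 < q.2 <= p.2.2 / 2 &
      forall z, rnorm (z - q.1) < q.2 -> p.1%:R < rnorm (T z)].
  case: p => n [x r] /=; have [r0|_] := ltP 0 r; last by exists (x, r).
  have r4 : 0 < r / 4 by rewrite divr_gt0.
  apply: contrapT => /forallNP bad; apply: noball.
  exists n, x, (r / 4); split=> // y yx e e0; apply: contrapT => far.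
  apply: (bad (y, Num.min e (r / 2))) => _ /=; split; first exact: ltW.
    by rewrite lt_min e0 divr_gt0//= ge_min lexx orbT.
  move=> z; rewrite lt_min => /andP[ze _]; rewrite ltNge; apply/negP => zn.
  by apply: far; exists z.
have [f fP] := choice step.
pose fix q n : X * R := if n is m.+1 then f (m, q m) else (0, 1).
have q0 n : 0 < (q n).2.
  elim: n => [|n IH]; first exact: ltr01.
  by have [_ /andP[]] := fP (n, q n) IH.
have qP n : [/\ rnorm ((q n.+1).1 - (q n).1) <= (q n).2 / 4,
    (q n.+1).2 <= (q n).2 / 2 &
    forall z, rnorm (z - (q n.+1).1) < (q n.+1).2 -> n%:R < rnorm (T z)].
  by have [? /andP[_ ?] ?] := fP (n, q n) (q0 n).
have q2 n : (q n).2 <= 1 / 2 ^+ n.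
  elim: n => [|n IH]; first by rewrite expr0 divr1.
  have [_ qn _] := qP n; apply: le_trans qn _.
  by rewrite exprSr invfM mulrA ler_pM2r ?invr_gt0.
(* The centre moves by at most a quarter of the radius and the radius at least halves, so the balls
   of half the radius are nested and the limit lies inside every full ball. *)
have nest k m : rnorm ((q (k + m)%N).1 - (q k).1) + (q (k + m)%N).2 / 2 <= (q k).2 / 2.
  elim: m => [|m IH]; first by rewrite addn0 subrr rnorm0 add0r.
  have [d r _] := qP (k + m)%N; rewrite addnS.
  have := rnormBD (q (k + m)%N).1 (q (k + m).+1).1 (q k).1.
  lra.
have [n|l lq] := @rnorm_geometric_cauchy _ X (fun n => (q n).1) 1.
  have [d _ _] := qP n; apply: le_trans d _; have := q2 n; have := q0 n.
  lra.
have lk k : rnorm (l - (q k).1) < (q k).2.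
  have [n nq] := geometric_lt (1 * 2) (divr_gt0 (q0 k) (ltr0n R 2)).
  have l1 := lq (k + n)%N; have l2 := nest k n.
  have l3 := rnormBD (q (k + n)%N).1 l (q k).1.
  have l4 : 1 * 2 / 2 ^+ (k + n) <= 1 * 2 / 2 ^+ n :> R.
    rewrite ler_pM2l ?lef_pV2 ?posrE ?exprn_gt0// ?mulr_gt0//.
    by rewrite ler_weXn2l ?ler1n// leq_addl.
  have := q0 (k + n)%N; lra.
have [n _ nl] : exists2 n : nat, True & rnorm (T l) < n%:R.
  by exists (Num.truncn (rnorm (T l))).+1 => //; exact: truncnS_gt.
have [_ _ /(_ l (lk n.+1))] := qP n.
by rewrite ltNge (ltW nl).
Qed.

(** The difference of two points of the sublevel set, near [x0 + t x] and near [x0], approximates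
    [t x]. The two errors [rho / 8] add up to half of [t * rnorm x = rho / 2]. *)
Lemma linear_approx : exists2 L : R, 0 <= L & forall x, exists y,
  rnorm (x - y) <= rnorm x / 2 /\ rnorm (T y) <= L * rnorm x.
Proof.
have [n [x0 [rho [rho0 nP]]]] := baire_linear_sublevel.
exists (4 * n%:R / rho); first by rewrite divr_ge0 ?mulr_ge0// ltW.
move=> x; have [->|x_neq0] := eqVneq x 0.
  by exists 0; rewrite subrr raddf0 !rnorm0 mul0r mulr0.
have x0' : 0 < rnorm x by rewrite rnorm_gt0.
pose t := rho / (2 * rnorm x).
have t0 : 0 < t by rewrite divr_gt0// mulr_gt0.
have tx : t * rnorm x = rho / 2 by rewrite /t; field; rewrite gt_eqF.
have e0 : 0 < rho / 8 by rewrite divr_gt0.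
have [|u ux Tu] := nP (x0 + cplx t *: x) _ _ e0.
  rewrite addrC addKr rnormZ rnorm_cplx gtr0_norm// tx; lra.
have [|w wx Tw] := nP x0 _ _ e0; first by rewrite subrr rnorm0.
have ct : cplx t != 0 by rewrite -cplx0 (inj_eq cplx_inj) gt_eqF.
have ti0 : 0 < t^-1 by rewrite invr_gt0.
exists ((cplx t)^-1 *: (u - w)); split.
  rewrite -[x in x - _](scalerK ct) -scalerBr rnormZ rnormV rnorm_cplx gtr0_norm//.
  rewrite mulrC ler_pdivrMr// mulrAC [_ * t]mulrC tx.
  have -> : cplx t *: x - (u - w) = (w - x0) - (u - (x0 + cplx t *: x)).
    by rewrite !opprB !addrA subrK [w + _]addrC.
  have := rnormD (w - x0) (- (u - (x0 + cplx t *: x))); rewrite rnormN; lra.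
rewrite linearZ/= rnormZ rnormV rnorm_cplx gtr0_norm// linearB.
rewrite mulrC ler_pdivrMr//.
have := rnormD (T u) (- T w); rewrite rnormN => TT.
have -> : 4 * n%:R / rho * rnorm x * t = 2 * n%:R.
  by rewrite -mulrA [_ * t]mulrC tx; field; rewrite gt_eqF.
lra.
Qed.

(** Iterating the approximation halves the residual [r k], so [T (x - r k)] is Cauchy with a
    controlled limit, which the closed graph identifies with [T x]. *)
Theorem closed_graph :
  (forall x y, (forall e : R, 0 < e -> exists2 x' : X,
      rnorm (x' - x) < e & rnorm (T x' - y) < e) -> T x = y) ->
  exists2 M : R, 0 <= M & forall x, rnorm (T x) <= M * rnorm x.
Proof.
move=> closedT; have [L L0 /choice[f fP]] := linear_approx.
exists (L * 2); first by rewrite mulr_ge0.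
move=> x; pose r k := iter k (fun z => z - f z) x.
have r_le k : rnorm (r k) <= rnorm x / 2 ^+ k.
  elim: k => [|k IH]; first by rewrite expr0 divr1.
  have [rk _] := fP (r k); apply: le_trans rk _.
  by rewrite exprSr invfM mulrA ler_pM2r ?invr_gt0.
have [k|y yT] := @rnorm_geometric_cauchy _ Y (fun k => T (x - r k)) (L * rnorm x).
  rewrite -linearB [r k.+1]/(r k - f (r k)) !opprB addrC addrA subrK addrC subrK.
  have [_ /le_trans->//] := fP (r k).
  by rewrite -mulrA ler_wpM2l.
have Ty : T x = y.
  apply: closedT => e e0.
  have [n xn] := geometric_lt (rnorm x) e0.
  have [m Lm] := geometric_lt (L * rnorm x * 2) e0.
  have mono (c : R) i j : 0 <= c -> (i <= j)%N -> c / 2 ^+ j <= c / 2 ^+ i.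
    move=> c0 ij; rewrite ler_wpM2l// lef_pV2 ?posrE ?exprn_gt0//.
    by rewrite ler_weXn2l ?ler1n.
  exists (x - r (maxn n m)).
    rewrite addrAC subrr add0r rnormN (le_lt_trans (r_le _))//.
    by rewrite (le_lt_trans _ xn)// mono ?rnorm_ge0// leq_maxl.
  rewrite rnormB (le_lt_trans (yT _))// (le_lt_trans _ Lm)// mono ?leq_maxr//.
  by rewrite !mulr_ge0 ?rnorm_ge0.
by have := yT 0%N; rewrite /r/= subrr linear0 subr0 Ty expr0 divr1 mulrAC.
Qed.

End ClosedGraph.

(** * Local behaviour of analytic functions *)

Section AnalyticFunctions.
Context {R : realType}.
Implicit Types (f : disc R -> C R) (a b z : disc R).

Lemma disc_lt1 a : rnorm (val a) < 1.
Proof. by rewrite -cplx_lt -rnormE; exact: set_mem (valP a). Qed.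

Lemma disc_intro (w : C R) : rnorm w < 1 -> exists a, val a = w.
Proof.
move=> w1; have dw : disc R w by rewrite /disc /= rnormE -cplx_lt in w1 *.
by exists (exist _ w (mem_set dw)).
Qed.

Lemma disc_punctured a (e : R) : 0 < e ->
  exists z, [/\ val z != val a & rnorm (val z - val a) < e].
Proof.
move=> e0; have a1 := disc_lt1 a.
pose t := Num.min e (1 - rnorm (val a)) / 2.
have t0 : 0 < t by rewrite divr_gt0// lt_min e0 subr_gt0.
have te : t < e by have := ge_min e e (1 - rnorm (val a)); rewrite lexx /= /t; lra.
have ta : t < 1 - rnorm (val a).
  by have := ge_min (1 - rnorm (val a)) e (1 - rnorm (val a)); rewrite lexx orbT /t; lra.
have [|z zt] := @disc_intro (val a + cplx t).
  by rewrite (le_lt_trans (rnormD _ _))// rnorm_cplx gtr0_norm//; lra.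
have za : val z - val a = cplx t by rewrite zt addrC addKr.
exists z; rewrite -subr_eq0 za -rnorm_gt0 rnorm_cplx gtr0_norm//.
Qed.

(** Convergence at one point [w] at distance [t] bounds [|c n| t ^ n]; comparison with a geometric
    series then controls the remainder within [t / 2]. *)
Lemma taylor_bound f a : analytic f ->
  exists (c : nat -> C R) (B rho : R), [/\ 0 <= B, 0 < rho &
    forall m z, rnorm (val z - val a) < rho ->
      rnorm (f z - \sum_(n < m) c n * (val z - val a) ^+ n) <=
      B * (rnorm (val z - val a) / rho) ^+ m].
Proof.
move=> /(_ a)[c /near_discP[e e0 ce]].
have [w [wa we]] := disc_punctured a e0.
pose t := rnorm (val w - val a).
have t0 : 0 < t by rewrite rnorm_gt0 subr_eq0.
pose S z m := \sum_(n < m) c n * (val z - val a) ^+ n.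
have SS z m : S z m.+1 - S z m = c m * (val z - val a) ^+ m.
  by rewrite /S big_ord_recr /= [X in X - _]addrC addrK.
have ceS z : rnorm (val z - val a) < e -> S z @ \oo --> f z.
  move=> /ce; rewrite (_ : series _ = S z)//; apply/funext => n.
  by rewrite /series /= big_mkord.
have [A A0 cA] : exists2 A : R, 0 <= A & forall n, rnorm (c n) * t ^+ n <= A.
  have /cvg_rnormP/(_ 1 ltr01)[N SN] := ceS w we.
  (* The sum covers the first [N] terms; a later one is a difference of two partial sums within 1 of
     the limit. *)
  exists (2 + \sum_(n < N) rnorm (c n) * t ^+ n).
    by rewrite addr_ge0// sumr_ge0// => n _; rewrite mulr_ge0 ?exprn_ge0 ?rnorm_ge0.
  move=> n; have [nN|Nn] := ltnP n N.
    rewrite (bigD1 (Ordinal nN)) //= addrCA lerDl addr_ge0// sumr_ge0// => i _.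
    by rewrite mulr_ge0 ?exprn_ge0 ?rnorm_ge0.
  have s0 : 0 <= \sum_(n < N) rnorm (c n) * t ^+ n.
    by rewrite sumr_ge0// => i _; rewrite mulr_ge0 ?exprn_ge0 ?rnorm_ge0.
  have <- : rnorm (S w n.+1 - S w n) = rnorm (c n) * t ^+ n.
    by rewrite SS rnormM rnormX.
  have := SN _ Nn; have := SN _ (leqW Nn).
  have := rnormBD (f w) (S w n.+1) (S w n); rewrite (rnormB (f w)); lra.
exists c, (2 * A), (t / 2); split; [by rewrite mulr_ge0| by rewrite divr_gt0|].
move=> m z zt; rewrite -/(S z m).
set y := rnorm (val z - val a) in zt *.
have y0 : 0 <= y by exact: rnorm_ge0.
pose x := y / t.
have x0 : 0 <= x by rewrite divr_ge0// ltW.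
have x2 : x <= 1 / 2 by rewrite ler_pdivrMr//; lra.
have xm k : 0 <= x ^+ k by rewrite exprn_ge0.
have tail k : rnorm (S z (m + k)%N - S z m) <= 2 * A * x ^+ m * (1 - 2 ^- k).
  elim: k => [|k IH]; first by rewrite addn0 subrr rnorm0 expr0 invr1 subrr mulr0.
  have term : rnorm (S z (m + k).+1 - S z (m + k)%N) <= A * x ^+ m * 2 ^- k.
    rewrite SS rnormM rnormX -/y.
    have -> : y = x * t by rewrite /x divfK// gt_eqF.
    rewrite exprMn mulrCA mulrC.
    rewrite (le_trans (ler_wpM2r (xm _) (cA _)))// exprD -mulrA !ler_wpM2l//.
    by rewrite -exprVn lerXn2r ?nnegrE ?invr_ge0// -div1r.
  rewrite addnS; have := rnormBD (S z (m + k)%N) (S z (m + k).+1) (S z m).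
  have -> : 2 ^- k.+1 = 2 ^- k / 2 :> R by rewrite exprSr invfM.
  lra.
have xy : x ^+ m <= (y / (t / 2)) ^+ m.
  have yt : y / (t / 2) = 2 * x by rewrite /x; field; rewrite gt_eqF.
  by rewrite yt; apply: lerXn2r; rewrite ?nnegrE; lra.
apply/ler_addgt0Pr => d d0.
have ze : rnorm (val z - val a) < e by apply: lt_trans we; rewrite -/t -/y; lra.
have /cvg_rnormP/(_ d d0)[N SN] := ceS z ze.
have := SN _ (leq_addl m N); have := tail N.
have := rnormBD (S z (m + N)%N) (f z) (S z m); rewrite (rnormB (f z) (S z (m + N)%N)).
have : 2 * A * x ^+ m * (1 - 2 ^- N) <= 2 * A * (y / (t / 2)) ^+ m.
  rewrite -!mulrA ler_wpM2l// ler_wpM2l// (le_trans _ xy)//.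
  by rewrite ler_piMr// gerBl invr_ge0 exprn_ge0.
lra.
Qed.

Lemma analytic_continuous f a : analytic f -> forall e : R, 0 < e ->
  exists2 d : R, 0 < d & forall z, rnorm (val z - val a) < d -> rnorm (f z - f a) < e.
Proof.
move=> /taylor_bound-/(_ a)[c [B [rho [B0 rho0 fB]]]] e e0.
have fa : f a = c 0%N.
  have := fB 1%N a; rewrite subrr rnorm0 big_ord1 expr0 mulr1 mul0r expr1 mulr0.
  by move=> /(_ rho0) h; apply/eqP; rewrite -subr_eq0 -rnorm_eq0 eq_le h rnorm_ge0.
exists (Num.min rho (e * rho / (B + 1))).
  by rewrite lt_min rho0 divr_gt0 ?mulr_gt0//; lra.
move=> z; rewrite lt_min => /andP[zr ze].
have := fB 1%N z zr; rewrite big_ord1 expr0 mulr1 expr1 -fa.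
move=> /le_lt_trans; apply; rewrite mulrA ltr_pdivrMr//.
have B1 : 0 < B + 1 by lra.
move: ze; rewrite ltr_pdivlMr//; have := rnorm_ge0 (val z - val a).
by nra.
Qed.

Lemma analytic_neq0 f a : analytic f -> f a != 0 ->
  exists2 d : R, 0 < d & forall z, rnorm (val z - val a) < d -> rnorm (f a) / 2 <= rnorm (f z).
Proof.
rewrite -rnorm_gt0 => af fa0.
have [d d0 fd] := analytic_continuous a af (divr_gt0 fa0 (ltr0n R 2)).
exists d => // z /fd; have := rnorm_dist (f a) (f z); rewrite rnormB; lra.
Qed.

Definition zero_near f (w : C R) :=
  exists2 e : R, 0 < e & forall z, rnorm (val z - w) < e -> f z = 0.

(** A lower bound stands in for vanishing to order at most [m]: it survives division by [z - a],
    with [m] lowered by one. *)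
Definition order_le f a (m : nat) :=
  exists c e : R, [/\ 0 < c, 0 < e & forall z, rnorm (val z - val a) < e ->
    c * rnorm (val z - val a) ^+ m <= rnorm (f z)].

Lemma zero_near_or_order f a : analytic f ->
  zero_near f (val a) \/ exists m, order_le f a m.
Proof.
move=> /taylor_bound-/(_ a)[c [B [rho [B0 rho0 fB]]]].
have [cn0|c0] := pselect (exists n, c n != 0); last first.
  left; exists (rho / 2); first by rewrite divr_gt0.
  move=> z zr; apply/eqP; rewrite -rnorm_eq0 eq_le rnorm_ge0 andbT.
  apply/ler_addgt0Pr => e e0; rewrite add0r.
  have [n Bn] := geometric_lt B e0.
  have zr' : rnorm (val z - val a) < rho by lra.
  have := fB n z zr'; rewrite big1; last first.
    move=> i _; have [->|ci] := eqVneq (c i) 0; first by rewrite mul0r.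
    by case: c0; exists i.
  rewrite subr0 => /le_trans; apply; apply: le_trans (ltW Bn).
  rewrite ler_wpM2l// -exprVn; apply: lerXn2r.
  - by rewrite nnegrE divr_ge0 ?rnorm_ge0// ltW.
  - by rewrite nnegrE.
  - by rewrite ler_pdivrMr//; lra.
right; exists (ex_minn cn0); case: ex_minnP => m cm mmin.
have cm0 : 0 < rnorm (c m) by rewrite rnorm_gt0.
(* Within the second radius the remainder is at most half of the leading term [c m (z - a) ^ m]; the
   [+ 1] guards against [B = 0]. *)
exists (rnorm (c m) / 2), (Num.min rho (rnorm (c m) / 2 * rho ^+ m.+1 / (B + 1))).
have rm : 0 < rho ^+ m.+1 by rewrite exprn_gt0.
split; first by rewrite divr_gt0.
  by rewrite lt_min rho0 divr_gt0 ?mulr_gt0 ?divr_gt0//; lra.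
move=> z; rewrite lt_min => /andP[zr zc].
have := fB m.+1 z zr; rewrite big_ord_recr /= big1 ?add0r; last first.
  move=> [i im] _ /=; have [->|ci] := eqVneq (c i) 0; first by rewrite mul0r.
  by have := mmin i ci; rewrite leqNgt im.
have := rnorm_dist (c m * (val z - val a) ^+ m) (f z).
rewrite rnormB rnormM rnormX.
set y := rnorm (val z - val a) in zr zc *.
have y0 : 0 <= y by exact: rnorm_ge0.
have ym : 0 <= y ^+ m by rewrite exprn_ge0.
have : B * (y / rho) ^+ m.+1 <= rnorm (c m) / 2 * y ^+ m.
  have -> : B * (y / rho) ^+ m.+1 = B * y / rho ^+ m.+1 * y ^+ m.
    by rewrite expr_div_n (exprS y); ring.
  rewrite ler_wpM2r// ler_pdivrMr//.
  have B1 : 0 < B + 1 by lra.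
  move: zc; rewrite ltr_pdivlMr// => zc; apply: le_trans (ltW zc).
  by nra.
lra.
Qed.

Lemma disc_segment a b (t : R) : 0 <= t <= 1 ->
  exists z, val z = val a + cplx t * (val b - val a).
Proof.
move=> /andP[t0 t1]; apply: disc_intro.
have -> : val a + cplx t * (val b - val a) =
    cplx (1 - t) * val a + cplx t * val b.
  by rewrite cplxD cplxN cplx1; ring.
rewrite (le_lt_trans (rnormD _ _))// !rnormM !rnorm_cplx !ger0_norm//; last by lra.
set M := Num.max (rnorm (val a)) (rnorm (val b)).
have M1 : M < 1 by rewrite gt_max !disc_lt1.
have aM : rnorm (val a) <= M by rewrite le_max lexx.
have bM : rnorm (val b) <= M by rewrite le_max lexx orbT.
have := ler_wpM2l t0 bM; have : (1 - t) * rnorm (val a) <= (1 - t) * M.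
  by rewrite ler_wpM2l//; lra.
lra.
Qed.

(* The set where an analytic function vanishes locally is relatively clopen in
   any segment of the disc; its indicator function would violate the
   intermediate value theorem. *)
Theorem identity_theorem f b : analytic f -> f b != 0 ->
  forall a, exists m, order_le f a m.
Proof.
move=> af fb a; have [za|//] := zero_near_or_order a af; exfalso.
(* Clamping to [0, 1] defines the path on the whole line, still Lipschitz and inside the disc. *)
pose tau (t : R) := Num.min 1 (Num.max 0 t).
have tau01 t : 0 <= tau t <= 1.
  by rewrite /tau le_min ge_min ler01 le_max !lexx.
have tauD s t : `|tau s - tau t| <= `|s - t|.
  rewrite /tau /Num.min /Num.max.
  by do ![case: ifP => /=]; move=> *; rewrite ?subrr ?normr0//; 
    rewrite ler_norml; apply/andP; split;
    have := ler_norm (s - t); have := ler_norm (t - s); rewrite distrC; lra.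
pose gam (t : R) : C R := val a + cplx (tau t) * (val b - val a).
have gamD s t : rnorm (gam s - gam t) <= `|s - t| * (rnorm (val b - val a) + 1).
  have -> : gam s - gam t = cplx (tau s - tau t) * (val b - val a).
    by rewrite /gam cplxD cplxN; ring.
  rewrite rnormM rnorm_cplx; apply: ler_pM => //; first exact: rnorm_ge0.
  by rewrite lerDl.
have gam_disc t : exists z : disc R, val z = gam t by exact: disc_segment.
pose chi (t : R) : R := if pselect (zero_near f (gam t)) then 1 else 0.
have local_cst t : \forall s \near t, chi s = chi t.
  have : exists2 e : R, 0 < e & forall s, rnorm (gam s - gam t) < e ->
      (zero_near f (gam s) <-> zero_near f (gam t)).
    have [z zt] := gam_disc t.
    have [zf|[m [c [e [c0 e0 fc]]]]] := zero_near_or_order z af.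
      move: zf; rewrite zt => zf; have [e e0 fe] := zf.
      exists (e / 2); first by rewrite divr_gt0.
      move=> s st; split=> // _; exists (e / 2); first by rewrite divr_gt0.
      by move=> y ys; apply: fe; have := rnormBD (gam s) (val y) (gam t); lra.
    exists e => // s st.
    have [zs|zs] := eqVneq (gam s) (gam t); first by rewrite zs.
    have nz y : rnorm (val y - gam t) < e -> val y != gam t -> f y != 0.
      rewrite -zt => ye yt; rewrite -rnorm_gt0; apply: lt_le_trans (fc _ ye).
      by rewrite mulr_gt0// exprn_gt0// rnorm_gt0 subr_eq0.
    split=> -[d d0 fd]; exfalso.
      have [y ys] := gam_disc s.
      have /negP[] : f y != 0 by apply: nz; rewrite ys.
      by apply/eqP; apply: fd; rewrite ys subrr rnorm0.
    have de0 : 0 < Num.min d e by rewrite lt_min d0 e0.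
    have [y [yz]] := disc_punctured z de0.
    rewrite lt_min zt => /andP[yd ye].
    have /negP[] : f y != 0 by apply: nz => //; rewrite -zt.
    by apply/eqP; exact: fd.
  move=> [e e0 he].
  have k0 : 0 < rnorm (val b - val a) + 1 by have := rnorm_ge0 (val b - val a); lra.
  apply/nbhs_ballP; exists (e / (rnorm (val b - val a) + 1)) => /=.
    by rewrite divr_gt0.
  move=> s; rewrite /ball/= distrC => st.
  have [|h1 h2] := he s.
    by rewrite (le_lt_trans (gamD _ _))// -ltr_pdivlMr.
  by rewrite /chi; case: pselect => p; case: pselect => q //; exfalso; auto.
have ccont : continuous chi.
  move=> t A At; apply: (filterS _ (local_cst t)) => s /= ->.
  exact: nbhs_singleton At.
have gam0 : gam 0 = val a.
  by rewrite /gam (_ : tau 0 = 0) ?cplx0 ?mul0r ?addr0// /tau maxxx minElt ltr10.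
have gam1 : gam 1 = val b.
  rewrite /gam (_ : tau 1 = 1) ?cplx1 ?mul1r 1?addrC ?subrK//.
  by rewrite /tau /Num.max ltr01 minxx.
have chi0 : chi 0 = 1 by rewrite /chi gam0; case: pselect.
have chi1 : chi 1 = 0.
  rewrite /chi gam1; case: pselect => // -[e e0 fe].
  by move: fb; rewrite fe ?eqxx// subrr rnorm0.
have [||t _] := @IVT R chi 0 1 (1 / 2) ler01.
- exact: continuous_subspaceT.
- by rewrite chi0 chi1 /Num.min /Num.max; do ![case: ifP => /=]; lra.
move=> /eqP; apply/negP; rewrite /chi; case: (pselect _) => _ /=.
  by rewrite gt_eqF//; lra.
by rewrite lt_eqF//; lra.
Qed.

End AnalyticFunctions.

(** * Functions concentrated along a sparse boundary sequence *)

Section GeometricConvergence.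
Context {R : realType}.
Implicit Types (u v : nat -> C R) (l m : C R).

Definition geo_cvg u l := exists K : R, forall n, rnorm (u n - l) <= K / 2 ^+ n.

Lemma geo_cvg_exists u (c : R) :
  (forall n, rnorm (u n.+1 - u n) <= c / 2 ^+ n) -> exists l, geo_cvg u l.
Proof.
move=> /complex_geometric_cauchy[l lu]; exists l, (c * 4) => n.
by rewrite rnormB.
Qed.

Lemma geo_cvgB u v l m : geo_cvg u l -> geo_cvg v m ->
  geo_cvg (fun n => u n - v n) (l - m).
Proof.
move=> [K uK] [L vL]; exists (K + L) => n.
have -> : u n - v n - (l - m) = (u n - l) - (v n - m) by ring.
by rewrite mulrDl (le_trans (rnormD _ _))// rnormN lerD.
Qed.

Lemma geo_cvgZ u l (a : C R) : geo_cvg u l -> geo_cvg (fun n => a * u n) (a * l).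
Proof.
move=> [K uK]; exists (rnorm a * K) => n.
by rewrite -mulrBr rnormM -mulrA ler_wpM2l// rnorm_ge0.
Qed.

Lemma geo_cvg_sum (I : Type) (r : seq I) (u : I -> nat -> C R) (l : I -> C R) :
  (forall i, geo_cvg (u i) (l i)) ->
  geo_cvg (fun n => \sum_(i <- r) u i n) (\sum_(i <- r) l i).
Proof.
move=> ul; elim: r => [|i r [K IH]].
  by exists 0 => n; rewrite !big_nil subrr rnorm0 mul0r.
have [L uL] := ul i; exists (L + K) => n.
rewrite !big_cons opprD addrACA mulrDl.
by rewrite (le_trans (rnormD _ _))// lerD.
Qed.

Lemma geo_cvg_lt u l (e : R) : geo_cvg u l -> 0 < e ->
  exists N, forall n, (N <= n)%N -> rnorm (u n - l) < e.
Proof.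
move=> [K uK] e0; have [N Ne] := geometric_lt K e0.
have K0 : 0 <= K by have := le_trans (rnorm_ge0 _) (uK 0%N); rewrite expr0 divr1.
exists N => n Nn; apply: le_lt_trans (uK n) _; apply: le_lt_trans Ne.
by rewrite ler_wpM2l// lef_pV2 ?posrE ?exprn_gt0// ler_weXn2l// ler1n.
Qed.

Lemma geo_cvg_le u l (B : R) N0 : geo_cvg u l ->
  (forall n, (N0 <= n)%N -> rnorm (u n) <= B) -> rnorm l <= B.
Proof.
move=> ul uB; apply/ler_addgt0Pr => e /(geo_cvg_lt ul)[N uN].
have := uN _ (leq_maxl N N0); have := uB _ (leq_maxr N N0).
by have := rnorm_dist l (u (maxn N N0)); rewrite rnormB; lra.
Qed.

Lemma geo_cvg_ge u l (B : R) N0 : geo_cvg u l ->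
  (forall n, (N0 <= n)%N -> B <= rnorm (u n)) -> B <= rnorm l.
Proof.
move=> ul uB; apply/ler_addgt0Pr => e /(geo_cvg_lt ul)[N uN].
have := uN _ (leq_maxl N N0); have := uB _ (leq_maxr N N0).
by have := rnorm_dist (u (maxn N N0)) l; lra.
Qed.

End GeometricConvergence.

Lemma analyticB (R : realType) (f g : disc R -> C R) :
  analytic f -> analytic g -> analytic (fun z => f z - g z).
Proof.
move=> af ag a; have [c cf] := af a; have [d dg] := ag a.
exists (fun n => c n - d n); apply: filterS2 cf dg => z cf dg.
apply/cvg_rnormP => e e0; have e2 : 0 < e / 2 by rewrite divr_gt0.
have [N cN] := (cvg_rnormP _ _).1 cf _ e2.
have [M dM] := (cvg_rnormP _ _).1 dg _ e2.
exists (maxn N M) => n; rewrite geq_max => /andP[/cN {}cN /dM {}dM].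
have -> : series (fun n => (c n - d n) * (val z - val a) ^+ n) n =
    series (fun n => c n * (val z - val a) ^+ n) n -
    series (fun n => d n * (val z - val a) ^+ n) n.
  rewrite /series /= -sumrB; apply: eq_bigr => i _; exact: mulrBl.
move: cN dM; set p := series _ n; set q := series _ n => cN dM.
have -> : p - q - (f z - g z) = (p - f z) - (q - g z) by ring.
by rewrite (le_lt_trans (rnormD _ _))// rnormN (splitr e) ltrD.
Qed.

(** * Rational bumps on the right half-plane *)

Section HalfPlane.
Context {R : realType}.
Variable w : C R.
Hypothesis w0 : 0 < complex.Re w.

Lemma rnorm_shift_sqr (d : R) :
  rnorm (cplx d + w) ^+ 2 = d ^+ 2 + 2 * d * complex.Re w + rnorm w ^+ 2.
Proof.
have sq (z : C R) : rnorm z ^+ 2 = complex.Re z ^+ 2 + complex.Im z ^+ 2.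
  by rewrite /rnorm normc_def /= sqr_sqrtr// addr_ge0 ?sqr_ge0.
by rewrite !sq; case: w => p q /=; ring.
Qed.

Lemma rnorm_shift_ge (d : R) : 0 <= d -> rnorm w <= rnorm (cplx d + w).
Proof.
move=> d0; rewrite -(ler_pXn2r (_ : 0 < 2)%N) ?nnegrE ?rnorm_ge0//.
rewrite rnorm_shift_sqr.
by have := mulr_ge0 d0 (ltW w0); have := sqr_ge0 d; lra.
Qed.

Lemma rnorm_shift_gt0 (d : R) : 0 <= d -> 0 < rnorm (cplx d + w).
Proof.
move=> d0; apply: lt_le_trans (rnorm_shift_ge d0); rewrite rnorm_gt0.
by apply: contraTneq w0 => ->; rewrite ltxx.
Qed.

Lemma rnorm_shift_le (d : R) : 0 <= d -> rnorm (cplx d + w) <= d + rnorm w.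
Proof. by move=> d0; rewrite (le_trans (rnormD _ _))// rnorm_cplx ger0_norm. Qed.

(** In the right half-plane [|d + w|^2 >= d^2 + |w|^2 >= (d + |w|)^2 / 2]; two such factors give the
    constant 2. *)
Lemma rnorm_shift_prod (d e : R) : 0 <= d -> 0 <= e ->
  (d + rnorm w) * (e + rnorm w) <= 2 * (rnorm (cplx d + w) * rnorm (cplx e + w)).
Proof.
have sq (x : R) : 0 <= x -> (x + rnorm w) ^+ 2 <= 2 * rnorm (cplx x + w) ^+ 2.
  move=> x0; rewrite rnorm_shift_sqr; have := sqr_ge0 (x - rnorm w).
  by have := mulr_ge0 x0 (ltW w0); lra.
move=> d0 e0; have t0 := rnorm_ge0 w.
rewrite -(ler_pXn2r (_ : 0 < 2)%N) ?nnegrE ?mulr_ge0 ?addr_ge0 ?rnorm_ge0//.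
have -> : (2 * (rnorm (cplx d + w) * rnorm (cplx e + w))) ^+ 2 =
  (2 * rnorm (cplx d + w) ^+ 2) * (2 * rnorm (cplx e + w) ^+ 2) by ring.
by rewrite exprMn ler_pM ?sq ?sqr_ge0.
Qed.

(* [bump d] equals [d w / ((d + w) (2 d + w))], which is bounded away from [0] for
   [|w| = d] and small for [|w|] far from [d]; its simple fractions have explicit
   Taylor expansions in [w]. *)
Definition bump (d : R) : C R :=
  cplx (2 * d) / (cplx (2 * d) + w) - cplx d / (cplx d + w).

Lemma bumpE (d : R) : 0 < d ->
  bump d = cplx d * w / ((cplx d + w) * (cplx (2 * d) + w)).
Proof.
move=> d0; have h1 : cplx d + w != 0 by rewrite -rnorm_gt0 rnorm_shift_gt0 ?ltW.
have h2 : cplx (2 * d) + w != 0 by rewrite -rnorm_gt0 rnorm_shift_gt0 ?mulr_ge0 ?ltW.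
rewrite /bump; move: h2; rewrite cplxM cplx_nat => h2.
by field; rewrite h1 h2.
Qed.

(* The right-hand side equals [2 * d * |w| / ((d + |w|) * (2 * d + |w|))], written so
   as to telescope along a sequence [d] that at least halves at each step. *)
Lemma bump_le (d : R) : 0 < d ->
  rnorm (bump d) <= 2 * (2 * d / (2 * d + rnorm w) - d / (d + rnorm w)).
Proof.
move=> d0; have t0 := rnorm_ge0 w; have d2 : 0 <= 2 * d by rewrite mulr_ge0// ltW.
have h1 : 0 < d + rnorm w by lra.
have h2 : 0 < 2 * d + rnorm w by lra.
have -> : 2 * (2 * d / (2 * d + rnorm w) - d / (d + rnorm w)) =
    2 * (d * rnorm w) / ((d + rnorm w) * (2 * d + rnorm w)).
  by field; rewrite !gt_eqF.
rewrite bumpE// !rnormM rnormV rnormM rnorm_cplx gtr0_norm//.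
have k1 := rnorm_shift_gt0 (ltW d0); have k2 := rnorm_shift_gt0 d2.
rewrite ler_pdivrMr ?mulr_gt0// mulrAC ler_pdivlMr ?mulr_gt0//.
have dw : 0 <= d * rnorm w by rewrite mulr_ge0// ltW.
rewrite (mulrC 2 (d * _)) -[leRHS]mulrA ler_wpM2l//.
exact: rnorm_shift_prod (ltW d0) d2.
Qed.

(** For [d = |w|] the numerator has modulus [d^2] and the factors of the denominator at most [2 d]
    and [3 d]. *)
Lemma bump_ge : 1 / 6 <= rnorm (bump (rnorm w)).
Proof.
have t0 : 0 < rnorm w.
  by have := rnorm_shift_gt0 (lexx 0); rewrite cplx0 add0r.
have t2 : 0 <= 2 * rnorm w by lra.
rewrite bumpE// !rnormM rnormV rnormM rnorm_cplx gtr0_norm//.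
have k1 := rnorm_shift_gt0 (ltW t0); have k2 := rnorm_shift_gt0 t2.
have l1 := rnorm_shift_le (ltW t0); have l2 := rnorm_shift_le t2.
rewrite ler_pdivlMr ?mulr_gt0//.
have := ler_pM (ltW k1) (ltW k2) l1 l2.
have -> : (rnorm w + rnorm w) * (2 * rnorm w + rnorm w) = 6 * (rnorm w * rnorm w).
  by ring.
lra.
Qed.

End HalfPlane.

Lemma sum_geometric_le (R : realType) (A : R) (s : nat -> R) N :
  0 <= A -> (forall n, s n <= A / 2 ^+ n) -> \sum_(n < N) s n <= 2 * A.
Proof.
move=> A_ge0 sA; have A0 : forall N, \sum_(n < N) s n <= 2 * A - 2 * A / 2 ^+ N.
  elim=> [|k IH]; first by rewrite big_ord0 expr0 divr1 subrr.
  rewrite big_ord_recr /=; have := sA k.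
  have -> : 2 * A / 2 ^+ k.+1 = A / 2 ^+ k.
    by rewrite exprS; field; rewrite expf_neq0.
  by move: IH; rewrite -[2 * A / _]mulrA; lra.
apply: le_trans (A0 N) _; by rewrite gerBl divr_ge0 ?exprn_ge0 ?mulr_ge0.
Qed.

(** * Sums of bumps along a sparse sequence *)

Section BumpSums.
Context {R : realType}.
Variable zeta : C R.
Hypothesis zeta1 : rnorm zeta = 1.

(** Sends the disc into the right half-plane and [zeta] to 0, keeping the distance to [zeta]. *)
Definition halfplane (z : disc R) : C R := 1 - val z / zeta.

Lemma zeta_neq0 : zeta != 0.
Proof. by rewrite -rnorm_gt0 zeta1. Qed.

Lemma halfplane_Re_gt0 z : 0 < complex.Re (halfplane z).
Proof.
have : `|complex.Re (val z / zeta)| < 1.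
  apply: le_lt_trans (Re_le_rnorm _) _.
  by rewrite rnormM rnormV zeta1 invr1 mulr1 disc_lt1.
rewrite /halfplane; case: (val z / zeta) => p q /=.
by have := ler_norm p; lra.
Qed.

Lemma rnorm_halfplane z : rnorm (halfplane z) = rnorm (val z - zeta).
Proof.
have -> : halfplane z = (zeta - val z) / zeta.
  by rewrite mulrBl divff ?zeta_neq0.
by rewrite rnormM rnormV zeta1 invr1 mulr1 rnormB.
Qed.

(** At [a] each fraction is a geometric series in [eta], of ratio at most 1/2 for all [n] at once
    because [|s n + w| >= |w|]. The sums over [n] and [j] are exchanged on finite truncations with
    an exact remainder, and then the limit in [n] is taken. *)
Lemma simple_fraction_sum (c : nat -> C R) (s : nat -> R) (A : R) :
  (forall n, rnorm (c n) <= 1) -> (forall n, 0 < s n) ->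
  (forall n, s n <= A / 2 ^+ n) ->
  exists2 G : disc R -> C R, analytic G & forall z, geo_cvg
    (fun N => \sum_(n < N) c n * (cplx (s n) / (cplx (s n) + halfplane z))) (G z).
Proof.
move=> c1 s0 sA.
have A0 : 0 <= A.
  by have := le_trans (ltW (s0 0%N)) (sA 0%N); rewrite expr0 divr1.
have w0 z : 0 < rnorm (halfplane z).
  by have := rnorm_shift_gt0 (halfplane_Re_gt0 z) (lexx 0); rewrite cplx0 add0r.
have sw z n : rnorm (halfplane z) <= rnorm (cplx (s n) + halfplane z).
  by apply: rnorm_shift_ge (ltW (s0 n)); exact: halfplane_Re_gt0.
have sw0 z n : cplx (s n) + halfplane z != 0.
  by rewrite -rnorm_gt0 (lt_le_trans (w0 z)).
have termle n (y : C R) (D : R) : 0 < D -> D <= rnorm y ->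
    rnorm (c n * (cplx (s n) / y)) <= s n / D.
  move=> D0 Dy; have y0 := lt_le_trans D0 Dy.
  rewrite !rnormM rnormV rnorm_cplx gtr0_norm// -[leRHS]mul1r.
  apply: ler_pM; rewrite ?c1 ?rnorm_ge0 ?divr_ge0 ?(ltW (s0 n)) ?(ltW y0)//.
  by rewrite ler_wpM2l ?lef_pV2 ?posrE// ltW.
have sAD n (D : R) : 0 < D -> s n / D <= A / D / 2 ^+ n.
  by move=> D0; rewrite [leRHS]mulrAC ler_wpM2r// invr_ge0 ltW.
have /choice[G GP] (z : disc R) : exists l, geo_cvg
    (fun N => \sum_(n < N) c n * (cplx (s n) / (cplx (s n) + halfplane z))) l.
  apply: (@geo_cvg_exists _ _ (A / rnorm (halfplane z))) => n.
  rewrite big_ord_recr /= [X in X - _]addrC addrK.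
  by apply: le_trans (sAD _ _ (w0 z)); exact: termle.
exists G => // a.
pose S j N := \sum_(n < N) c n * (cplx (s n) / (cplx (s n) + halfplane a) ^+ j.+1).
have /choice[b bP] (j : nat) : exists l, geo_cvg (S j) l.
  apply: (@geo_cvg_exists _ _ (A / rnorm (halfplane a) ^+ j.+1)) => n.
  have wj : 0 < rnorm (halfplane a) ^+ j.+1 by rewrite exprn_gt0.
  rewrite /S big_ord_recr /= [X in X - _]addrC addrK.
  apply: le_trans (sAD _ _ wj); apply: termle => //.
  by rewrite rnormX; apply: lerXn2r; rewrite ?nnegrE ?rnorm_ge0.
exists (fun j => b j * zeta^-1 ^+ j).
apply/near_discP; exists (rnorm (halfplane a) / 2); first by rewrite divr_gt0.
move=> z za; apply/cvg_rnormP => e e0.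
set eta := (val z - val a) / zeta.
have wE : halfplane z = halfplane a - eta by rewrite /halfplane /eta; ring.
have etaE : rnorm eta = rnorm (val z - val a).
  by rewrite rnormM rnormV zeta1 invr1 mulr1.
pose x := rnorm eta / rnorm (halfplane a).
have x0 : 0 <= x by rewrite divr_ge0 ?rnorm_ge0.
have x2 : x <= 1 / 2 by rewrite ler_pdivrMr// etaE; lra.
have expand n k : cplx (s n) / (cplx (s n) + halfplane z) =
    \sum_(j < k) eta ^+ j * (cplx (s n) / (cplx (s n) + halfplane a) ^+ j.+1) +
    eta ^+ k * cplx (s n) / ((cplx (s n) + halfplane a) ^+ k * (cplx (s n) + halfplane z)).
  elim: k => [|k IH]; first by rewrite big_ord0 add0r !expr0 !mul1r.
  rewrite IH big_ord_recr /= -addrA; congr (_ + _).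
  have := sw0 z n; have := sw0 a n; rewrite wE.
  move: (cplx (s n)) (halfplane a) => p q pq pqe.
  rewrite !exprS; field.
  by rewrite pq expf_neq0//= pqe.
have rest k : rnorm (G z - \sum_(j < k) eta ^+ j * b j) <=
    2 * A / rnorm (halfplane z) * x ^+ k.
  apply: (@geo_cvg_le _ (fun N => \sum_(n < N) c n * (cplx (s n) / (cplx (s n) + halfplane z)) -
      \sum_(j < k) eta ^+ j * S j N) _ _ 0%N).
    have bs := @geo_cvg_sum R 'I_k (index_enum _)
      (fun j N => eta ^+ j * S j N) (fun j => eta ^+ j * b j) (fun j => geo_cvgZ _ (bP j)).
    exact: geo_cvgB (GP z) bs.
  move=> N _.
  have -> : \sum_(n < N) c n * (cplx (s n) / (cplx (s n) + halfplane z)) -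
      \sum_(j < k) eta ^+ j * S j N = \sum_(n < N) c n *
    (eta ^+ k * cplx (s n) / ((cplx (s n) + halfplane a) ^+ k * (cplx (s n) + halfplane z))).
    under [X in _ - X]eq_bigr do rewrite /S mulr_sumr.
    rewrite exchange_big -sumrB; apply: eq_bigr => n _.
    under eq_bigr do rewrite mulrCA.
    by rewrite -mulr_sumr -mulrBr; congr (_ * _); rewrite (expand n k) addrC addrA addNr add0r.
  apply: le_trans (rnorm_sum _ _ _) _.
  have wzk : 0 < rnorm (halfplane a) ^+ k * rnorm (halfplane z).
    by rewrite mulr_gt0 ?exprn_gt0.
  apply: (@le_trans _ _ (\sum_(n < N) s n * (x ^+ k / rnorm (halfplane z)))).
    apply: ler_sum => n _; rewrite -mulrA mulrCA rnormM rnormX.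
    have -> : s n * (x ^+ k / rnorm (halfplane z)) =
        rnorm eta ^+ k * (s n / (rnorm (halfplane a) ^+ k * rnorm (halfplane z))).
      by rewrite /x expr_div_n invfM; ring.
    rewrite ler_wpM2l ?exprn_ge0 ?rnorm_ge0//; apply: termle => //.
    rewrite rnormM rnormX ler_pM ?exprn_ge0 ?rnorm_ge0//.
    by apply: lerXn2r; rewrite ?nnegrE ?rnorm_ge0.
  rewrite -mulr_suml -mulrA [X in _ <= _ * X]mulrC.
  by rewrite ler_wpM2r ?divr_ge0 ?exprn_ge0 ?rnorm_ge0// sum_geometric_le.
have [n0 n0e] := geometric_lt (2 * A / rnorm (halfplane z)) e0.
exists n0 => n n0n; apply: le_lt_trans n0e.
rewrite rnormB /series /= big_mkord.
rewrite (eq_bigr (fun j : 'I_n => eta ^+ j * b j)); last first.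
  by move=> j _; rewrite /eta exprMn; ring.
apply: le_trans (rest n) _; rewrite ler_wpM2l ?divr_ge0 ?mulr_ge0 ?rnorm_ge0//.
apply: (@le_trans _ _ ((1 / 2) ^+ n)).
  by apply: lerXn2r; rewrite ?nnegrE.
rewrite div1r exprVn lef_pV2 ?posrE ?exprn_gt0// ler_weXn2l// ler1n//.
Qed.

Variable d : nat -> R.
Hypothesis d_gt0 : forall n, 0 < d n.
Hypothesis d_dec : forall n, 100 * d n.+1 <= d n.

Lemma radius_geometric n : d n <= d 0%N / 2 ^+ n.
Proof.
elim: n => [|n IH]; first by rewrite expr0 divr1.
rewrite exprSr invfM mulrA; have := d_dec n; have := d_gt0 n.+1.
by move: IH; lra.
Qed.

Section Telescope.
Variable w : C R.
Hypothesis w0 : 0 < complex.Re w.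
Local Notation t := (rnorm w).

(** With [phi x = x / (x + t)] increasing, [bump_le] bounds each bump by [2 (phi (2 d) - phi d)],
    and [2 d (n + 1) <= d n] makes these bounds telescope. *)
Lemma bump_sum_le a k :
  \sum_(i < k.+1) rnorm (bump w (d (a + i))) <=
  2 * (2 * d a / (2 * d a + t) - d (a + k) / (d (a + k) + t)).
Proof.
have t0 := rnorm_ge0 w.
elim: k => [|k IH].
  by rewrite big_ord_recl big_ord0 addr0 addn0; exact: bump_le.
rewrite big_ord_recr /= addnS; have b := bump_le w0 (d_gt0 (a + k).+1).
have : 2 * d (a + k).+1 / (2 * d (a + k).+1 + t) <= d (a + k)%N / (d (a + k)%N + t).
  have := d_dec (a + k); have := d_gt0 (a + k); have := d_gt0 (a + k).+1.
  move: (d (a + k).+1) (d (a + k)%N) => x y x0 y0 xy.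
  have xt : 0 < 2 * x + t by lra.
  have yt : 0 < y + t by lra.
  rewrite ler_pdivrMr// mulrAC ler_pdivlMr//.
  have : 0 <= t * (y - 2 * x) by rewrite mulr_ge0//; lra.
  lra.
lra.
Qed.

Lemma bump_sum_le2 k : \sum_(i < k) rnorm (bump w (d i)) <= 2.
Proof.
have t0 := rnorm_ge0 w; case: k => [|k]; first by rewrite big_ord0.
have := bump_sum_le 0 k; under eq_bigr do rewrite add0n.
move=> /le_trans; apply.
have : 0 <= d (0 + k) / (d (0 + k) + t).
  by have := d_gt0 (0 + k); move=> ?; rewrite divr_ge0//; lra.
have : 2 * d 0%N / (2 * d 0%N + t) <= 1.
  by have := d_gt0 0%N => ?; rewrite ler_pdivrMr; lra.
lra.
Qed.

(** At [|w| = d n] the earlier bumps contribute at most [2 (1 - 99/100)] and the later ones at most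
    [2 * 2/100], against 1/6 for the bump of index [n]; what remains exceeds 1/20. *)
Lemma bump_sum_ge (c : nat -> C R) n : rnorm w = d n ->
  (forall m, rnorm (c m) <= rnorm (c n)) ->
  forall N, (n < N)%N ->
    rnorm (c n) / 20 <= rnorm (\sum_(m < N) c m * bump w (d m)).
Proof.
move=> wn cn N nN; set B := rnorm (c n).
have B0 : 0 <= B by exact: rnorm_ge0.
have t0 : 0 < t by rewrite wn.
have le_sum k (f : nat -> nat) : rnorm (\sum_(i < k) c (f i) * bump w (d (f i))) <=
    B * \sum_(i < k) rnorm (bump w (d (f i))).
  rewrite (le_trans (rnorm_sum _ _ _))// mulr_sumr ler_sum// => i _.
  by rewrite rnormM ler_wpM2r ?rnorm_ge0 ?cn.
have before : \sum_(i < n) rnorm (bump w (d i)) <= 2 / 100.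
  case: n wn cn nN @B B0 le_sum => [|n] wn _ _ _ _ _; first by rewrite big_ord0 divr_ge0.
  have := bump_sum_le 0 n; under eq_bigr do rewrite add0n.
  move=> /le_trans; apply; rewrite add0n wn.
  have := d_gt0 0%N; have := d_gt0 n; have := d_gt0 n.+1; have := d_dec n.
  move: (d n.+1) (d n) (d 0%N) => x y z xy x0 y0 z0.
  have h1 : 2 * z / (2 * z + x) <= 1 by rewrite ler_pdivrMr; lra.
  have h2 : 99 / 100 <= y / (y + x) by rewrite ler_pdivlMr; lra.
  lra.
have after k : \sum_(i < k) rnorm (bump w (d (n.+1 + i))) <= 4 / 100.
  case: k => [|k]; first by rewrite big_ord0 divr_ge0.
  apply: le_trans (bump_sum_le n.+1 k) _; rewrite wn.
  have h2 : 0 <= d (n.+1 + k) / (d (n.+1 + k) + d n).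
    by rewrite divr_ge0 ?addr_ge0 ?ltW.
  have h1 : 2 * d n.+1 / (2 * d n.+1 + d n) <= 2 / 100.
    have := d_gt0 n; have := d_gt0 n.+1; have := d_dec n.
    by move=> *; rewrite ler_pdivrMr; lra.
  lra.
have := bump_ge w0; rewrite wn => mid.
have -> : N = (n.+1 + (N - n.+1))%N by rewrite subnKC.
rewrite big_split_ord /= big_ord_recr /=.
set S1 : C R := \sum_(i < n) _; set S2 : C R := \sum_(i < _) _.
have h1 : rnorm S1 <= B * (2 / 100).
  by apply: le_trans (le_sum _ id) _; rewrite ler_wpM2l.
have h2 : rnorm S2 <= B * (4 / 100).
  by apply: le_trans (le_sum _ (addn n.+1)) _; rewrite ler_wpM2l.
have h3 : B * (1 / 6) <= rnorm (c n * bump w (d n)) by rewrite rnormM ler_wpM2l.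
have := rnorm_dist (c n * bump w (d n)) (- (S1 + S2)).
have := rnormD S1 S2; rewrite rnormN opprK.
have -> : c n * bump w (d n) + (S1 + S2) = S1 + c n * bump w (d n) + S2 by ring.
lra.
Qed.

End Telescope.

(** Analyticity comes from the two series of simple fractions. Each of these may be unbounded, so
    the bound is taken on the recombined bumps. *)
Lemma bounded_bump_series (c : nat -> C R) : (forall n, rnorm (c n) <= 1) ->
  exists2 psi : disc R -> C R, Hinfty R psi & forall z,
    geo_cvg (fun N => \sum_(n < N) c n * bump (halfplane z) (d n)) (psi z).
Proof.
move=> c1.
have dA n : d n <= 2 * d 0%N / 2 ^+ n.
  apply: le_trans (radius_geometric n) _; rewrite -mulrA ler_peMl ?ler1n//.
  by rewrite divr_ge0 ?exprn_ge0 ?ltW.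
have d2A n : 2 * d n <= 2 * d 0%N / 2 ^+ n by rewrite -mulrA ler_wpM2l// radius_geometric.
have d2_gt0 n : 0 < 2 * d n by rewrite mulr_gt0.
have [G aG GP] := simple_fraction_sum c1 d_gt0 dA.
have [G2 aG2 G2P] := simple_fraction_sum c1 d2_gt0 d2A.
have psiP z : geo_cvg (fun N => \sum_(n < N) c n * bump (halfplane z) (d n)) (G2 z - G z).
  have := geo_cvgB (G2P z) (GP z); rewrite (_ : (fun N => _ - _) =
    (fun N => \sum_(n < N) c n * bump (halfplane z) (d n)))//.
  apply/funext => N; rewrite -sumrB; apply: eq_bigr => n _.
  by rewrite -mulrBr.
exists (fun z => G2 z - G z); last exact: psiP.
split; first exact: analyticB.
exists 2; split=> [|M M2 z _ /=]; first exact: realn.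
apply: le_trans (ltW M2); rewrite rnormE -(cplx_nat 2) cplx_le.
apply: (geo_cvg_le (N0 := 0%N) (psiP z)) => N _.
apply: le_trans (bump_sum_le2 (halfplane_Re_gt0 z) N).
rewrite (le_trans (rnorm_sum _ _ _))// ler_sum// => n _.
by rewrite rnormM ler_piMl ?rnorm_ge0.
Qed.

Lemma boundary_independent_functions (K : nat) (z_ : nat -> disc R) :
  (forall n, rnorm (val (z_ n) - zeta) = d n) ->
  exists psi : 'I_K -> disc R -> C R, (forall j, Hinfty R (psi j)) /\
    forall lambda : 'I_K -> C R, (exists j, lambda j != 0) ->
      exists2 c : R, 0 < c & forall N, exists2 n, (N <= n)%N &
        c <= rnorm (\sum_j lambda j * psi j (z_ n)).
Proof.
move=> zd.
(* psi j collects the bumps at the points of index congruent to j modulo K. *)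
pose e (j : 'I_K) (n : nat) : C R := (n %% K == j)%N%:R.
have e1 j n : rnorm (e j n) <= 1.
  by rewrite /e; case: (_ == _); rewrite ?rnorm1 ?rnorm0 ?ler01.
have /choice[psi psiP] (j : 'I_K) : exists psi : disc R -> C R, Hinfty R psi /\
    forall z, geo_cvg (fun N => \sum_(n < N) e j n * bump (halfplane z) (d n)) (psi z).
  by have [psi] := bounded_bump_series (e1 j); exists psi.
exists psi; split=> [j|lambda [j1 lj1]]; first exact: (psiP j).1.
have K0 : (0 < K)%N by case: j1 {lj1} => m; exact: leq_ltn_trans.
(* At indices congruent to [j0] the bump carries the largest coefficient, as [bump_sum_ge]
   demands. *)
pose j0 := [arg max_(j > j1) rnorm (lambda j)]%O.
have j0P j : rnorm (lambda j) <= rnorm (lambda j0).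
  by rewrite /j0; case: arg_maxP => // i _ /(_ j); exact.
have lj0 : 0 < rnorm (lambda j0) by apply: lt_le_trans (j0P j1); rewrite rnorm_gt0.
exists (rnorm (lambda j0) / 20); first by rewrite divr_gt0.
move=> N; pose n := (N * K + j0)%N.
exists n; first by rewrite (leq_trans (leq_pmulr N K0))// leq_addr.
pose c m := \sum_j lambda j * e j m.
have cE m (j : 'I_K) : (m %% K)%N = j -> c m = lambda j.
  move=> mj; rewrite /c (bigD1 j)//= /e mj eqxx mulr1 big1 ?addr0// => i ij.
  by case: eqP => [/ord_inj ji|_]; rewrite ?mulr0//; rewrite ji eqxx in ij.
have cn : c n = lambda j0 by apply: cE; rewrite /n modnMDl modn_small.
have cs := @geo_cvg_sum R 'I_K (index_enum _) _ _
  (fun j => geo_cvgZ (lambda j) ((psiP j).2 (z_ n))).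
apply: (geo_cvg_ge (N0 := n.+1) cs) => M nM.
have -> : \sum_j lambda j * \sum_(m < M) e j m * bump (halfplane (z_ n)) (d m) =
    \sum_(m < M) c m * bump (halfplane (z_ n)) (d m).
  under eq_bigr do rewrite mulr_sumr.
  rewrite exchange_big; apply: eq_bigr => m _.
  by rewrite /c mulr_suml; apply: eq_bigr => j _; rewrite mulrA.
rewrite -cn; apply: bump_sum_ge => //.
- exact: halfplane_Re_gt0.
- by rewrite rnorm_halfplane.
- by move=> m; rewrite cn (cE m (Ordinal (ltn_pmod m K0)))//; exact: j0P.
Qed.

End BumpSums.

(** * Spaces of analytic functions and their multipliers *)

Lemma analytic_is_continuous (R : realType) (f : disc R -> C R) :
  analytic f -> continuous f.
Proof.
move=> af a A /nbhs_rnormP[e e0 eA].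
have [d d0 fd] := analytic_continuous a af e0.
by apply/near_discP; exists d => // z /fd; exact: eA.
Qed.

(** Extends identities to the points where a cancelled factor, [z - a] or [v z], vanishes. *)
Lemma continuous_eq_dense (R : realType) (f g : disc R -> C R) :
  continuous f -> continuous g ->
  (forall (a : disc R) (e : R), 0 < e ->
    exists2 z : disc R, rnorm (val z - val a) < e & f z = g z) ->
  f = g.
Proof.
move=> cf cg fg; apply/funext => a; apply/eqP; rewrite -subr_eq0 -rnorm_eq0.
rewrite eq_le rnorm_ge0 andbT; apply/ler_addgt0Pr => e e0; rewrite add0r.
have e2 : 0 < e / 2 by rewrite divr_gt0.
have near (k : disc R -> C R) : continuous k -> exists2 d : R, 0 < d &
    forall z : disc R, rnorm (val z - val a) < d -> rnorm (k z - k a) < e / 2.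
  move=> ck; have ka : nbhs (k a) [set w : C R | rnorm (w - k a) < e / 2].
    by apply/nbhs_rnormP; exists (e / 2).
  by apply/(near_discP a (fun z => rnorm (k z - k a) < e / 2)); exact: (ck a _ ka).
have [d d0 fd] := near f cf; have [d' d'0 gd] := near g cg.
have [|z] := fg a (Num.min d d'); first by rewrite lt_min d0.
rewrite lt_min => /andP[/fd fz /gd gz] fgz.
by have := rnormBD (f z) (f a) (g a); move: fz gz; rewrite fgz (rnormB _ (f a)); lra.
Qed.

Section FunctionSpace.
Context {R : realType} {X : completeNormedModType (C R)}.
Variable ev : {linear X -> (disc R -> C R)}.
Hypothesis evX : space_of_analytic_functions ev.
Hypothesis const_X : contains_constants ev.
Hypothesis cond_I : finer_than_compact_open ev.
Hypothesis cond_IV : division_property ev.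

Lemma ev_analytic f : analytic (ev f).
Proof. exact: evX.2. Qed.

Lemma ev_continuous f : continuous (ev f).
Proof. exact/analytic_is_continuous/ev_analytic. Qed.

Lemma evE a f g z : ev (a *: f + g) z = a * ev f z + ev g z.
Proof. by rewrite linearP. Qed.

Lemma evD f g z : ev (f + g) z = ev f z + ev g z.
Proof. by rewrite linearD. Qed.

Lemma evB f g z : ev (f - g) z = ev f z - ev g z.
Proof. by rewrite linearB. Qed.

Lemma evZ a f z : ev (a *: f) z = a * ev f z.
Proof. by rewrite linearZ. Qed.

Lemma ev_eq_off (a : disc R) (f g : X) :
  (forall z : disc R, val z != val a -> ev f z = ev g z) -> f = g.
Proof.
move=> fg; apply: evX.1.
apply: continuous_eq_dense; try exact: ev_continuous.
move=> b e e0; have [ba|ba] := eqVneq (val b) (val a).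
  have [z [zb ze]] := disc_punctured b e0; exists z => //.
  by apply: fg; rewrite -ba.
by exists b; [rewrite subrr rnorm0|exact: fg].
Qed.

(** Condition (I) at 0, tested on the compact set [[set z]] and the open unit disc, then
    rescaled. *)
Lemma ev_bounded (z : disc R) :
  exists2 c : R, 0 <= c & forall x, rnorm (ev x z) <= c * rnorm x.
Proof.
have [d d0 dP] : exists2 d : R, 0 < d & forall x, rnorm x < d -> rnorm (ev x z) < 1.
  have c0 : ev x @[x --> (0 : X)] --> (ev 0 : {compact-open, disc R -> C R}).
    exact: cond_I.
  have oU : open [set w : C R | rnorm w < 1].
    rewrite openE => w /= w1; apply/nbhs_rnormP; exists (1 - rnorm w).
      by rewrite subr_gt0.
    by move=> y yw; have := rnorm_dist y w; rewrite /=; lra.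
  have [|d d0 dP] := (nbhs_rnormP _ _).1 ((compact_open_cvgP _ _).1 c0 [set z]
      [set w : C R | rnorm w < 1] (@compact_set1 _ z) oU _).
    by move=> _ [_ -> <-] /=; rewrite raddf0 /= rnorm0.
  exists d => // x xd.
  by have := dP x; rewrite subr0 => /(_ xd); apply; exists z.
exists (2 / d); first by rewrite divr_ge0// ltW.
move=> x; have [->|x_neq0] := eqVneq x 0.
  by rewrite raddf0 /= !rnorm0 mulr0.
have x0 : 0 < rnorm x by rewrite rnorm_gt0.
pose t := d / (2 * rnorm x).
have t0 : 0 < t by rewrite divr_gt0// mulr_gt0.
have tx : t * rnorm x = d / 2 by rewrite /t; field; rewrite gt_eqF.
have := dP (cplx t *: x); rewrite evZ rnormZ rnormM !rnorm_cplx gtr0_norm// tx.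
have d2 : d / 2 < d by lra.
move=> /(_ d2); rewrite mulrC -ltr_pdivlMr// => /ltW/le_trans; apply.
by rewrite /t div1r invf_div mulrAC.
Qed.

(** Bounded evaluations at the points other than [a] separate the elements of [X], which closes the
    graph. The point [a] is exempt because quotients by [z - a] are controlled off it. *)
Lemma ev_closed_graph (T : {linear X -> X}) (a : disc R) :
  (forall z : disc R, val z != val a ->
    exists c : R, forall x, rnorm (ev (T x) z) <= c * rnorm x) ->
  exists2 M : R, 0 <= M & forall x, rnorm (T x) <= M * rnorm x.
Proof.
move=> Tz; apply: closed_graph => x y xy.
apply: (@ev_eq_off a) => z /Tz[c cT]; have [c' c'0 cE] := ev_bounded z.
apply/eqP; rewrite -subr_eq0 -rnorm_eq0 eq_le rnorm_ge0 andbT.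
apply/ler_addgt0Pr => e e0; rewrite add0r.
have k0 : 0 < `|c| + c' + 1 by have := normr_ge0 c; lra.
set d := e / (`|c| + c' + 1).
have d0 : 0 < d by rewrite divr_gt0.
have dE : d * (`|c| + c' + 1) = e by rewrite divfK// gt_eqF.
have [x' xx' yx'] := xy d d0.
have h1 := cT (x - x'); have h2 := cE (T x' - y).
move: h1 h2; rewrite linearB !evB (rnormB x) => h1 h2.
have h3 : c * rnorm (x' - x) <= `|c| * d.
  by rewrite (le_trans (ler_wpM2r (rnorm_ge0 _) (ler_norm c)))// ler_wpM2l// ltW.
have h4 : c' * rnorm (T x' - y) <= c' * d by rewrite ler_wpM2l// ltW.
have := rnormBD (ev (T x') z) (ev (T x) z) (ev y z).
rewrite -dE; lra.
Qed.

Lemma one_exists : exists one : X, ev one = cst 1.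
Proof. by have [one _ <-] := const_X 1; exists one. Qed.

Lemma multiplier_intro (v : disc R -> C R) :
  (forall f, exists g, ev g = v \* ev f) -> multipliers ev v.
Proof.
move=> vX; split; last by move=> f; have [g <-] := vX f; exists g.
have [one ev1] := one_exists; have [g gE] := vX one.
rewrite (_ : v = ev g); first exact: ev_analytic.
by rewrite gE ev1; apply/funext => z /=; rewrite mulr1.
Qed.

Lemma multiplier_elim (v : disc R -> C R) (f : X) : multipliers ev v ->
  exists g, ev g = v \* ev f.
Proof. by move=> [_ /(_ f)[g _ <-]]; exists g. Qed.

Lemma multiplier_ev (v : disc R -> C R) : multipliers ev v -> exists g, ev g = v.
Proof.
have [one ev1] := one_exists; move=> /(multiplier_elim one)[g gE].
by exists g; rewrite gE ev1; apply/funext => z /=; rewrite mulr1.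
Qed.

Lemma multiplier_sub_cst (v : disc R -> C R) (c : C R) :
  multipliers ev v -> multipliers ev (fun z => v z - c).
Proof.
move=> Mv; apply: multiplier_intro => f; have [g gE] := multiplier_elim f Mv.
exists (g - c *: f); apply/funext => z.
by rewrite evB evZ gE /= mulrBl.
Qed.

Lemma division (f : X) (a : disc R) : ev f a = 0 ->
  exists g : X, forall z, ev f z = (val z - val a) * ev g z.
Proof.
move=> fa; have [g gE] := cond_IV fa; exists g => z.
have [->|za] := eqVneq z a; first by rewrite fa subrr mul0r.
by rewrite gE// mulrC divfK// subr_eq0; apply: contra za => /eqP/val_inj->.
Qed.

(** For [f] in [X], [v f] vanishes at [a], so (IV) gives an element of [X] that agrees with [k f]
    off [a], hence everywhere. *)
Lemma multiplier_division (v : disc R -> C R) (a : disc R) :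
  multipliers ev v -> v a = 0 ->
  exists2 k, multipliers ev k & forall z, v z = (val z - val a) * k z.
Proof.
move=> Mv va; have [x xE] := multiplier_ev Mv.
have [g gE] : exists g : X, forall z, ev x z = (val z - val a) * ev g z.
  by apply: division; rewrite xE.
exists (ev g); last by move=> z; rewrite -xE.
apply: multiplier_intro => f; have [y yE] := multiplier_elim f Mv.
have [w wE] : exists w : X, forall z, ev y z = (val z - val a) * ev w z.
  by apply: division; rewrite yE /= va mul0r.
exists w; apply: continuous_eq_dense; first exact: ev_continuous.
  by move=> z; apply: continuousM; exact: ev_continuous.
move=> b e e0.
have off (z : disc R) : val z != val a -> ev w z = ev g z * ev f z.
  rewrite -subr_eq0 => za; apply: (mulfI za).
  by rewrite -wE yE mulrA -gE xE.
have [ba|ba] := eqVneq (val b) (val a).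
  have [z [zb ze]] := disc_punctured b e0; exists z => //.
  by apply: off; rewrite -ba.
by exists b; [rewrite subrr rnorm0|exact: off].
Qed.

(* For [h] constant this is the backward shift at [a]. *)
Lemma bounded_shift (h : X) (a : disc R) : ev h a != 0 ->
  exists T : {linear X -> X},
    (forall x z, (val z - val a) * ev (T x) z = ev x z - ev x a / ev h a * ev h z) /\
    exists2 M : R, 0 <= M & forall x, rnorm (T x) <= M * rnorm x.
Proof.
move=> ha.
have /choice[T0 T0E] (x : X) : exists y : X,
    forall z, (val z - val a) * ev y z = ev x z - ev x a / ev h a * ev h z.
  have [|g gE] := @division (x - (ev x a / ev h a) *: h) a.
    by rewrite evB evZ divfK// subrr.
  by exists g => z; rewrite -gE evB evZ.
have T0lin : linear T0.
  move=> c x y; apply: (@ev_eq_off a) => z; rewrite -subr_eq0 => za.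
  apply: (mulfI za); rewrite evE T0E mulrDr mulrCA !T0E !evE.
  by ring.
pose T : {linear X -> X} := HB.pack T0 (GRing.isLinear.Build _ _ _ _ T0 T0lin).
exists T; split; first exact: T0E.
apply: (@ev_closed_graph T a) => z; rewrite -subr_eq0 => za.
have [cz cz0 czP] := ev_bounded z; have [ca ca0 caP] := ev_bounded a.
exists ((cz + ca / rnorm (ev h a) * rnorm (ev h z)) / rnorm (val z - val a)) => x.
have z0 : 0 < rnorm (val z - val a) by rewrite rnorm_gt0.
rewrite mulrAC ler_pdivlMr// mulrC -rnormM T0E.
rewrite (le_trans (rnormD _ _))// rnormN mulrDl lerD// !rnormM rnormV.
have -> : ca / rnorm (ev h a) * rnorm (ev h z) * rnorm x =
    ca * rnorm x / rnorm (ev h a) * rnorm (ev h z) by ring.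
by rewrite ler_wpM2r ?rnorm_ge0// ler_wpM2r ?invr_ge0 ?rnorm_ge0.
Qed.

(* The Taylor coefficients and remainders of [1 / h] at [a] are produced by iterating
   the shift [T]: [1 / h = sum_(j < n) b_j zeta ^ j + zeta ^ n T^n(1) / h], and the
   remainder vanishes as soon as [|zeta| ||T|| < 1]. *)
Lemma reciprocal_analytic (h : X) : (forall z, ev h z != 0) ->
  analytic (fun z => (ev h z)^-1).
Proof.
move=> h0 a; have [one ev1] := one_exists.
have [T [TE [M M0 TM]]] := bounded_shift (h0 a).
pose k n := iter n T one.
have kM n : rnorm (k n) <= M ^+ n * rnorm one.
  elim: n => [|n IH]; first by rewrite expr0 mul1r.
  by rewrite (le_trans (TM _))// exprS -mulrA ler_wpM2l.
exists (fun n => ev (k n) a / ev h a).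
apply/near_discP; exists (1 / (2 * (M + 1))); first by rewrite divr_gt0// mulr_gt0//; lra.
move=> z za; apply/cvg_rnormP => e e0.
set zeta := val z - val a in za *.
have expansion n : (ev h z)^-1 = series (fun n => ev (k n) a / ev h a * zeta ^+ n) n +
    zeta ^+ n * ev (k n) z / ev h z.
  elim: n => [|n IH].
    by rewrite /series /= big_geq// add0r expr0 mul1r ev1 /= mul1r.
  rewrite [LHS]IH seriesSr -addrA; congr (_ + _).
  have /eqP := TE (k n) z; rewrite -/zeta eq_sym subr_eq => /eqP ->.
  rewrite -/(k n.+1) exprSr; field; rewrite !h0//.
have [c c0 cE] := ev_bounded z.
have zM : rnorm zeta * M <= 1 / 2.
  have : rnorm zeta * (2 * (M + 1)) <= 1.
    by rewrite -ler_pdivlMr ?ltW// mulr_gt0//; lra.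
  by have := rnorm_ge0 zeta; lra.
have [n0 n0e] := geometric_lt (c * rnorm one / rnorm (ev h z)) e0.
exists n0 => n n0n; rewrite rnormB [X in X - _](expansion n) addrC addKr.
rewrite !rnormM rnormV rnormX; apply: le_lt_trans n0e.
have hz : 0 < rnorm (ev h z) by rewrite rnorm_gt0.
rewrite [leRHS]mulrAC ler_wpM2r ?invr_ge0 ?rnorm_ge0//.
have : rnorm zeta ^+ n * rnorm (ev (k n) z) <=
    (rnorm zeta * M) ^+ n * (c * rnorm one).
  rewrite exprMn -mulrA ler_wpM2l ?exprn_ge0 ?rnorm_ge0// (le_trans (cE _))//.
  by rewrite mulrCA ler_wpM2l.
move=> /le_trans; apply; rewrite [leRHS]mulrC ler_wpM2r ?mulr_ge0 ?rnorm_ge0//.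
apply: (@le_trans _ _ ((1 / 2) ^+ n)).
  by apply: lerXn2r; rewrite ?nnegrE ?mulr_ge0 ?rnorm_ge0.
rewrite div1r exprVn lef_pV2 ?posrE ?exprn_gt0// ler_weXn2l// ler1n//.
Qed.

(** * The range of a multiplication operator *)

Lemma bounded_rnorm_continuous (T : {linear X -> X}) (M : R) :
  (forall x, rnorm (T x) <= M * rnorm x) -> continuous T.
Proof.
move=> TM x A /nbhs_rnormP[e e0 eA].
have k0 : 0 < `|M| + 1 by have := normr_ge0 M; lra.
apply/nbhs_rnormP; exists (e / (`|M| + 1)); first by rewrite divr_gt0.
move=> y; rewrite ltr_pdivlMr// => yx; apply: eA; rewrite -linearB.
rewrite (le_lt_trans (TM _))// (le_lt_trans _ yx)// mulrC ler_wpM2l ?rnorm_ge0//.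
by have := ler_norm M; lra.
Qed.

Lemma closed_rnormP (A : set X) :
  closed A <-> forall x, (forall e : R, 0 < e ->
    exists2 y, A y & rnorm (y - x) < e) -> A x.
Proof.
split=> [cA x xA|cA x xA].
  apply: cA => B /nbhs_rnormP[e e0 eB].
  by have [y Ay yx] := xA e e0; exists y; split=> //; exact: eB.
apply: cA => e e0.
have xe : nbhs x [set y | rnorm (y - x) < e] by apply/nbhs_rnormP; exists e.
by have [y [Ay yx]] := xA _ xe; exists y.
Qed.

Lemma nonzero_dense (v : disc R -> C R) (b : disc R) : analytic v -> v b != 0 ->
  forall (a : disc R) (e : R), 0 < e ->
    exists2 z : disc R, rnorm (val z - val a) < e & v z != 0.
Proof.
move=> av vb a e e0; have [m [c [d [c0 d0 vm]]]] := identity_theorem av vb a.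
have ed : 0 < Num.min e d by rewrite lt_min e0.
have [z [za]] := disc_punctured a ed; rewrite lt_min => /andP[ze zd].
exists z => //; rewrite -rnorm_gt0 (lt_le_trans _ (vm _ zd))// mulr_gt0//.
by rewrite exprn_gt0// rnorm_gt0 subr_eq0.
Qed.

Lemma mul_ev_inj (v : disc R -> C R) (b : disc R) : analytic v -> v b != 0 ->
  forall f g, v \* ev f = v \* ev g -> f = g.
Proof.
move=> av vb f g fg; apply: evX.1.
apply: continuous_eq_dense; try exact: ev_continuous.
move=> a e e0; have [z za vz] := nonzero_dense av vb a e0.
by exists z => //; apply: (mulfI vz); have := congr1 (@^~ z) fg.
Qed.

(** Depends on the function alone, so that [v] can be exchanged for its factors. *)
Definition mult_range (v : disc R -> C R) : set X :=
  [set x | exists f, ev x = v \* ev f].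

(** With [T] the backward shift at [a], [x] lies in the range for [v] exactly when [x] vanishes at
    [a] and [T x] lies in the range for [k]; both conditions pass to limits. *)
Lemma mult_range_linear_factor (k v : disc R -> C R) (a : disc R) :
  multipliers ev k -> (forall z, v z = (val z - val a) * k z) ->
  closed (mult_range k) /\ finite_codim (mult_range k) ->
  closed (mult_range v) /\ finite_codim (mult_range v).
Proof.
move=> Mk vk [/closed_rnormP ck [n [e eP]]].
have [one ev1] := one_exists.
have one0 : ev one a != 0 by rewrite ev1 oner_neq0.
have [T [TE [M M0 TM]]] := bounded_shift one0.
have {}TE x z : ev x z = (val z - val a) * ev (T x) z + ev x a.
  by rewrite TE ev1 /= invr1 !mulr1 subrK.
split.
  apply/closed_rnormP => x xlim.
  have xa : ev x a = 0.
    apply/eqP; rewrite -rnorm_eq0 eq_le rnorm_ge0 andbT.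
    apply/ler_addgt0Pr => d d0; rewrite add0r.
    have [c c0 cE] := ev_bounded a.
    have c1 : 0 < c + 1 by lra.
    have [y [f yE] yx] := xlim (d / (c + 1)) (divr_gt0 d0 c1).
    have ya : ev y a = 0 by rewrite yE /= vk subrr !mul0r.
    have := cE (x - y); rewrite evB ya subr0 rnormB => /le_trans; apply.
    move: yx; rewrite ltr_pdivlMr// => yx; have := rnorm_ge0 (y - x); lra.
  have [|f fE] := ck (T x).
    move=> d d0; have M1 : 0 < M + 1 by lra.
    have [y [f yE] yx] := xlim (d / (M + 1)) (divr_gt0 d0 M1).
    exists (T y); last first.
      rewrite -linearB (le_lt_trans (TM _))//; move: yx.
      by rewrite ltr_pdivlMr//; have := rnorm_ge0 (y - x); lra.
    exists f; have [w wE] := multiplier_elim f Mk; rewrite -wE; congr (ev _).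
    apply: (@ev_eq_off a) => z; rewrite -subr_eq0 => za; apply: (mulfI za).
    have ya : ev y a = 0 by rewrite yE /= vk subrr !mul0r.
    by have := TE y z; rewrite ya addr0 => <-; rewrite yE wE /= vk mulrA.
  exists f; apply/funext => z.
  by rewrite TE xa addr0 fE /= vk mulrA.
(* Since [k f = v (T f) + f(a) k], the one additional generator is [k] itself. *)
have [p pE] := multiplier_ev Mk.
exists n.+1, (fun i => if unlift ord0 i is Some j then e j else p).
move=> x; have [c [f fE]] := eP x.
exists (fun i => if unlift ord0 i is Some j then c j else ev f a).
rewrite big_ord_recl unlift_none.
under eq_bigr do rewrite liftK.
exists (T f); apply/funext => z.
rewrite opprD addrCA addrC evB fE evZ pE /= (TE f z) vk.
by ring.
Qed.

(** Removes every factor [z - a], the order bound [m] ending the recursion; [strip] then treats a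
    cofactor that is nonzero at [a]. *)
Lemma mult_range_strip (a : disc R) (m : nat) (v : disc R -> C R) :
  multipliers ev v -> order_le v a m ->
  (forall n k, multipliers ev k -> k a != 0 ->
    (forall z, v z = (val z - val a) ^+ n * k z) ->
    closed (mult_range k) /\ finite_codim (mult_range k)) ->
  closed (mult_range v) /\ finite_codim (mult_range v).
Proof.
elim: m v => [|m IH] v Mv [c [d [c0 d0 vd]]] strip.
  apply: (strip 0%N v) => //; last by move=> z; rewrite expr0 mul1r.
  have := vd a; rewrite subrr rnorm0 expr0 mulr1 => /(_ d0) cv.
  by rewrite -rnorm_gt0 (lt_le_trans c0).
have [va|va] := eqVneq (v a) 0; last first.
  by apply: (strip 0%N v) => // z; rewrite expr0 mul1r.
have [k Mk vk] := multiplier_division Mv va.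
apply: (mult_range_linear_factor Mk vk); apply: IH => //; last first.
  move=> n k' Mk' k'a kk'; apply: (strip n.+1 k') => // z.
  by rewrite vk kk' exprS mulrA.
have off z : rnorm (val z - val a) < d -> val z != val a ->
    c * rnorm (val z - val a) ^+ m <= rnorm (k z).
  move=> zd za; have y0 : 0 < rnorm (val z - val a) by rewrite rnorm_gt0 subr_eq0.
  by have := vd z zd; rewrite vk rnormM exprS mulrCA ler_pM2l.
exists c, d; split=> // z zd; have [za|za] := eqVneq (val z) (val a); last exact: off.
(* At [a] itself the bound follows by continuity if the exponent is 0 and is trivial otherwise. *)
rewrite (val_inj za) subrr rnorm0; case: m off {vd} => [|m] off.
  rewrite expr0 mulr1 leNgt; apply/negP => kc.
  have kc0 : 0 < c - rnorm (k a) by rewrite subr_gt0.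
  have [d' d'0 kd] := analytic_continuous a Mk.1 kc0.
  have dd' : 0 < Num.min d d' by rewrite lt_min d0 d'0.
  have [y [ya]] := disc_punctured a dd'; rewrite lt_min => /andP[yd yd'].
  have := off y yd ya; rewrite expr0 mulr1.
  by have := kd y yd'; have := rnorm_dist (k y) (k a); lra.
by rewrite expr0n mulr0 rnorm_ge0.
Qed.

Hypothesis MX : multipliers ev = Hinfty R.

Lemma bounded_fun_rnormP (v : disc R -> C R) :
  bounded_fun v <-> exists B : R, forall z, rnorm (v z) <= B.
Proof.
split=> [[M [_ /(_ (M + 1)) vM]]|[B vB]].
  exists (complex.Re (M + 1)) => z.
  have vz : `|v z| <= M + 1 by apply: vM => //; rewrite ltrDl.
  by rewrite -cplx_le -cplx_Re -?rnormE// (le_trans (normr_ge0 _) vz).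
exists (cplx B); split=> [|M BM z _ /=].
  by rewrite realE cplx_ge0 (cplx_le B 0) le_total.
by rewrite (le_trans _ (ltW BM))// rnormE cplx_le.
Qed.

Lemma mult_range_bounded_below (v : disc R -> C R) (c : R) :
  multipliers ev v -> 0 < c -> (forall z, c <= rnorm (v z)) ->
  mult_range v = setT.
Proof.
move=> Mv c0 cv; have [h hE] := multiplier_ev Mv.
have v0 z : v z != 0 by rewrite -rnorm_gt0 (lt_le_trans c0).
have : Hinfty R (fun z => (v z)^-1).
  split; first by rewrite -hE; apply: reciprocal_analytic => z; rewrite hE.
  apply/bounded_fun_rnormP; exists c^-1 => z.
  by rewrite rnormV lef_pV2 ?posrE// (lt_le_trans c0).
rewrite -MX => Mv'; apply/seteqP; split=> // x _.
have [f fE] := multiplier_elim x Mv'; exists f; apply/funext => z.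
by rewrite [RHS]/= fE /= mulVKf.
Qed.

Lemma seq_lower_bound (T : eqType) (g : T -> R) (s : seq T) :
  (forall a, 0 < g a) -> exists2 c : R, 0 < c & forall a, a \in s -> c <= g a.
Proof.
move=> g0; elim: s => [|a s [c c0 cs]]; first by exists 1.
exists (Num.min c (g a)); first by rewrite lt_min c0 g0.
move=> b; rewrite inE => /predU1P[->|/cs]; first by rewrite ge_min lexx orbT.
by rewrite ge_min => ->.
Qed.

Lemma nonvanishing_bounded_below (v : disc R -> C R) (r eps : R) :
  analytic v -> (forall z, v z != 0) -> r < 1 -> 0 < eps ->
  (forall z : disc R, r <= rnorm (val z) -> eps <= rnorm (v z)) ->
  exists2 c : R, 0 < c & forall z, c <= rnorm (v z).
Proof.
move=> av v0 r1 eps0 veps.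
have /choice[g gP] (a : C R) : exists p : R * R, [/\ 0 < p.1, 0 < p.2 &
    forall z : disc R, rnorm (val z - a) < p.1 -> rnorm (val z) < r ->
      p.2 <= rnorm (v z)].
  (* Around a centre outside the open disc, radius [1 - r] leaves no point with [|z| < r], so the
     value 1 is arbitrary. *)
  have [a1|a1] := ltP (rnorm a) 1; last first.
    exists (1 - r, 1); split=> //=; first by rewrite subr_gt0.
    by move=> z za zr; have := rnorm_dist a (val z); rewrite rnormB; lra.
  have [b ba] := disc_intro a1; have [d d0 vd] := analytic_neq0 av (v0 b).
  exists (d, rnorm (v b) / 2); split=> //=; first by rewrite divr_gt0// rnorm_gt0.
  by move=> z za _; apply: vd; rewrite ba.
have g1 a : 0 < (g a).1 by case: (gP a).
have g2 a : 0 < (g a).2 by case: (gP a).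
have [s sP] := closed_disc_cover g1; have [c c0 cs] := seq_lower_bound s g2.
exists (Num.min c eps); first by rewrite lt_min c0.
move=> z; rewrite ge_min; have [zr|zr] := leP r (rnorm (val z)).
  by rewrite (veps _ zr) orbT.
have [a /cs ca za] := sP (val z) (ltW (disc_lt1 z)).
by have [_ _ /(_ z za zr)/(le_trans ca)->] := gP a.
Qed.

(** Zeros are isolated, so a covering disc contains no zero except possibly its centre, and the
    finite list of centres suffices. *)
Lemma finite_zeros (v : disc R -> C R) (b : disc R) (r : R) :
  analytic v -> v b != 0 -> r < 1 ->
  (forall z : disc R, r <= rnorm (val z) -> v z != 0) ->
  exists s : seq (C R), forall z, v z = 0 -> val z \in s.
Proof.
move=> av vb r1 vr.
have /choice[g gP] (a : C R) : exists d : R, 0 < d /\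
    forall z : disc R, rnorm (val z - a) < d -> v z = 0 -> val z = a.
  have [a1|a1] := ltP (rnorm a) 1; last first.
    exists (1 - r); split=> //=; first by rewrite subr_gt0.
    move=> z za vz; have /eqP[] : v z != 0; last by [].
    by apply: vr; have := rnorm_dist a (val z); rewrite rnormB; lra.
  have [a' a'a] := disc_intro a1.
  have [m [c [d [c0 d0 vm]]]] := identity_theorem av vb a'.
  exists d; split=> // z za vz; apply/eqP; apply: contraT => z_neq_a.
  have := vm z; rewrite a'a vz rnorm0 => /(_ za); rewrite leNgt mulr_gt0//.
  by rewrite exprn_gt0// rnorm_gt0 subr_eq0.
have [s sP] := closed_disc_cover (fun a => (gP a).1).
exists s => z vz; have [a sa za] := sP (val z) (ltW (disc_lt1 z)).
by rewrite ((gP a).2 z za vz).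
Qed.

Lemma mult_range_closed_finite_codim (v : disc R -> C R) (r eps : R) :
  multipliers ev v -> 0 < r < 1 -> 0 < eps ->
  (forall z : disc R, r <= rnorm (val z) -> eps <= rnorm (v z)) ->
  closed (mult_range v) /\ finite_codim (mult_range v).
Proof.
move=> Mv /andP[r0 r1] eps0 veps.
have [b b_r] : exists b : disc R, r <= rnorm (val b).
  have [|b bE] := @disc_intro _ (cplx r); first by rewrite rnorm_cplx gtr0_norm.
  by exists b; rewrite bE rnorm_cplx gtr0_norm.
have veps0 (w : disc R -> C R) (d : R) : 0 < d ->
    (forall z : disc R, r <= rnorm (val z) -> d <= rnorm (w z)) ->
    forall z : disc R, r <= rnorm (val z) -> w z != 0.
  by move=> d0 wd z /wd; rewrite -rnorm_gt0; exact: lt_le_trans.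
have [s sP] := finite_zeros Mv.1 (veps0 v eps eps0 veps b b_r) r1
  (veps0 v eps eps0 veps).
elim: s v eps Mv eps0 veps sP => [|a s IH] v eps Mv eps0 veps sP.
  have [|c c0 vc] := nonvanishing_bounded_below Mv.1 _ r1 eps0 veps.
    by move=> z; apply/eqP => /sP.
  rewrite (mult_range_bounded_below Mv c0 vc); split; first exact: closedT.
  by exists 0%N, (fun=> 0) => x; exists (fun=> 0).
(* The list may contain points that are not zeros: those outside the disc are dropped, the others
   stripped with exponent [n = 0]. *)
have [a1|a1] := ltP (rnorm a) 1; last first.
  apply: (IH v eps) => // z vz; have := sP z vz; rewrite inE => /predU1P[za|//].
  by move: a1; rewrite -za leNgt disc_lt1.
have [a' a'a] := disc_intro a1.
have [m vm] := identity_theorem Mv.1 (veps0 v eps eps0 veps b b_r) a'.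
apply: (mult_range_strip Mv vm) => n k Mk ka vk.
have two0 : 0 < 2 ^+ n :> R by rewrite exprn_gt0.
(* As [|z - a| < 2] on the disc, dividing out [n] factors costs at most [2 ^ n]. *)
apply: (IH k (eps / 2 ^+ n)) => //; first by rewrite divr_gt0.
- move=> z /veps; rewrite vk rnormM rnormX => vz.
  rewrite ler_pdivrMr// mulrC (le_trans vz)// ler_wpM2r ?rnorm_ge0//.
  apply: lerXn2r; rewrite ?nnegrE ?rnorm_ge0//.
  have := rnormD (val z) (- val a'); rewrite rnormN.
  by have := disc_lt1 z; have := disc_lt1 a'; lra.
- move=> z kz; have := sP z; rewrite vk kz mulr0 => /(_ erefl).
  rewrite inE => /predU1P[za|//]; move: ka.
  by rewrite -(_ : z = a') ?kz ?eqxx//; apply: val_inj; rewrite za.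
Qed.

Lemma mult_operator_sub_cst (u : disc R -> C R) (Mu : multipliers ev u) (c : C R) f :
  ev ((mult_operator evX Mu \- c \*: idfun) f) = (fun z => u z - c) \* ev f.
Proof.
apply/funext => z; rewrite /= evB evZ (mult_opE Mu f) /=.
by rewrite mulrBl.
Qed.

Lemma fredholm_mult_operator (u : disc R -> C R) (Mu : multipliers ev u)
    (c : C R) (r eps : R) :
  0 < r < 1 -> 0 < eps ->
  (forall z : disc R, r <= rnorm (val z) -> eps <= rnorm (u z - c)) ->
  fredholm (mult_operator evX Mu \- c \*: idfun).
Proof.
move=> r01 eps0 ueps; pose v z := u z - c.
set T := (X in fredholm X).
have Mv : multipliers ev v by exact: multiplier_sub_cst.
have Tv f : ev (T f) = v \* ev f by exact: mult_operator_sub_cst.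
have [cl fc] := mult_range_closed_finite_codim Mv r01 eps0 ueps.
have rT : range T = mult_range v.
  apply/seteqP; split=> [_ [f _ <-]|x [f xE]]; first by exists f.
  by exists f => //; apply: evX.1; rewrite Tv.
have /andP[r0 r1] := r01.
have [b bE] : exists b : disc R, val b = cplx r.
  by apply: disc_intro; rewrite rnorm_cplx gtr0_norm.
have vb : v b != 0.
  by rewrite -rnorm_gt0 (lt_le_trans eps0)// ueps// bE rnorm_cplx gtr0_norm.
split; rewrite ?rT//.
- have [M _ TM] : exists2 M : R, 0 <= M & forall x, rnorm (T x) <= M * rnorm x.
    apply: (@ev_closed_graph T b) => z _; have [d d0 dP] := ev_bounded z.
    exists (rnorm (v z) * d) => x.
    by rewrite Tv /= rnormM -mulrA ler_wpM2l// rnorm_ge0.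
  exact: bounded_rnorm_continuous TM.
- exists 0%N, (fun=> 0); split=> [[]//|x Tx]; exists (fun=> 0); rewrite big_ord0.
  by apply: (mul_ev_inj Mv.1 vb); rewrite -!Tv (raddf0 T); congr (ev _).
Qed.

(** * Multipliers tending to zero along a boundary sequence *)

Lemma ev_sum (I : Type) (r : seq I) (F : I -> X) z :
  ev (\sum_(i <- r) F i) z = \sum_(i <- r) ev (F i) z.
Proof.
elim: r => [|i r IH]; first by rewrite !big_nil raddf0.
by rewrite !big_cons evD IH.
Qed.

Lemma mult_range_sum (v : disc R -> C R) (I : Type) (r : seq I) (c : I -> C R)
    (F : I -> X) : (forall i, mult_range v (F i)) ->
  mult_range v (\sum_(i <- r) c i *: F i).
Proof.
move=> vF; elim: r => [|i r [g gE]].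
  by rewrite big_nil; exists 0; apply/funext => z; rewrite /= !raddf0 /= mulr0.
have [f fE] := vF i; exists (c i *: f + g); rewrite big_cons.
by apply/funext => z; rewrite evE fE gE /= evE mulrDr mulrCA.
Qed.

Lemma dependent_matrices (n : nat) (A : 'I_(n * n).+1 -> 'M[C R]_n) :
  exists2 lambda : 'I_(n * n).+1 -> C R, (exists j, lambda j != 0) &
    \sum_j lambda j *: A j = 0.
Proof.
pose B : 'M[C R]_((n * n).+1, n * n) := \matrix_j mxvec (A j).
have : kermx B != 0.
  rewrite kermx_eq0 /row_free neq_ltn; apply/orP; left.
  by rewrite ltnS rank_leq_col.
move=> /rowV0Pn[l /sub_kermxP lB l0].
exists (l 0).
  by have /rV0Pn[j lj] := l0; exists j.
apply/matrixP => i k; rewrite summxE mxE.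
have := congr1 (fun M : 'rV_(n * n) => M 0 (mxvec_index i k)) lB.
rewrite /= [LHS]mxE [RHS]mxE; apply: etrans; apply: eq_bigr => j _.
by rewrite !mxE mxvecE.
Qed.

(* The quotient of [X] by the range of multiplication by [v] is a module over
   [Hinfty R]; having dimension [n], it is annihilated by a nontrivial combination
   of any [n * n + 1] functions, and an annihilating function is a multiple of [v]. *)
Lemma finite_codim_divisible (v : disc R -> C R) :
  multipliers ev v -> finite_codim (mult_range v) ->
  exists K : nat, forall psi : 'I_K -> disc R -> C R, (forall j, Hinfty R (psi j)) ->
    exists2 lambda : 'I_K -> C R, (exists j, lambda j != 0) &
    exists (q : disc R -> C R) (B : R), (forall z, rnorm (q z) <= B) /\
      forall z, \sum_j lambda j * psi j z = v z * q z.
Proof.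
move=> Mv [n [e eP]]; exists (n * n).+1 => psi psiH.
have Mpsi j : multipliers ev (psi j) by rewrite MX.
have /choice[y yE] (p : 'I_(n * n).+1 * 'I_n) :
    exists y : X, ev y = psi p.1 \* ev (e p.2) by exact: multiplier_elim.
(* The numbers [a (j, i) l] form the matrix of multiplication by [psi j] modulo the range. *)
have /choice[a aP] (p : 'I_(n * n).+1 * 'I_n) :
    exists c : 'I_n -> C R, mult_range v (y p - \sum_l c l *: e l) by exact: eP.
have [lambda l0 lA] := dependent_matrices (fun j => \matrix_(i, l) a (j, i) l).
exists lambda => //.
pose Psi z := \sum_j lambda j * psi j z.
have Psi_e i : mult_range v (\sum_j lambda j *: y (j, i)).
  have -> : \sum_j lambda j *: y (j, i) =
      \sum_j lambda j *: (y (j, i) - \sum_l a (j, i) l *: e l).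
    under [RHS]eq_bigr do rewrite scalerBr scaler_sumr.
    rewrite sumrB exchange_big [X in _ - X]big1 ?subr0// => l _ /=.
    under eq_bigr do rewrite scalerA.
    rewrite -scaler_suml (_ : \sum_j lambda j * a (j, i) l = 0) ?scale0r//.
    have := congr1 (fun M : 'M[C R]_n => M i l) lA; rewrite summxE [RHS]mxE.
    by apply: etrans; apply: eq_bigr => j _; rewrite !mxE.
  by apply: mult_range_sum => j; exact: aP.
have /choice[w wE] (i : 'I_n) : exists w : X, forall z, Psi z * ev (e i) z = v z * ev w z.
  have [w wE] := Psi_e i; exists w => z.
  have := congr1 (@^~ z) wE; rewrite /= => <-; rewrite ev_sum mulr_suml.
  by apply: eq_bigr => j _; rewrite evZ yE /= mulrA.
have Psi_mult (f : X) : exists h : X, forall z, Psi z * ev f z = v z * ev h z.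
  have [c [g gE]] := eP f.
  have /choice[k kE] (j : 'I_(n * n).+1) : exists k : X, ev k = psi j \* ev g.
    exact: multiplier_elim.
  exists (\sum_i c i *: w i + \sum_j lambda j *: k j) => z.
  have -> : ev f z = \sum_i c i * ev (e i) z + v z * ev g z.
    rewrite -[f in LHS](subrK (\sum_i c i *: e i)) evD addrC gE ev_sum.
    by congr (_ + _); apply: eq_bigr => i _; rewrite evZ.
  rewrite evD !ev_sum !mulrDr; congr (_ + _).
    rewrite !mulr_sumr; apply: eq_bigr => i _.
    by rewrite evZ mulrCA wE mulrCA.
  rewrite mulrCA; congr (_ * _); rewrite mulr_suml; apply: eq_bigr => j _.
  by rewrite evZ kE /= mulrA.
have [one ev1] := one_exists; have [h hE] := Psi_mult one.
have {}hE z : Psi z = v z * ev h z by rewrite -hE ev1 /= mulr1.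
have [[b vb]|v0] := pselect (exists b, v b != 0); last first.
  exists (fun=> 0), 0; split=> z; first by rewrite rnorm0.
  rewrite -/(Psi z) hE mulr0; have [->|vz] := eqVneq (v z) 0; first by rewrite mul0r.
  by exfalso; apply: v0; exists z.
(* [Psi f = v g] forces [g = h f] where [v] is nonzero, which is a dense set. *)
have : multipliers ev (ev h).
  apply: multiplier_intro => f; have [g gE] := Psi_mult f; exists g.
  apply: continuous_eq_dense; first exact: ev_continuous.
    by move=> z; apply: continuousM; exact: ev_continuous.
  move=> z d d0; have [z' z'd vz'] := nonzero_dense Mv.1 vb z d0.
  by exists z' => //; apply: (mulfI vz'); rewrite -gE hE /= mulrA.
rewrite MX => -[_ /bounded_fun_rnormP[B hB]].
by exists (ev h), B.
Qed.

(** Otherwise finitely many discs cover the closed disc: those centred off the circle miss a thin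
    annulus inside it, and those centred on it carry a lower bound for [v]. *)
Lemma boundary_cluster_point (v : disc R -> C R) :
  (forall r eps : R, 0 < r < 1 -> 0 < eps ->
    exists2 z : disc R, r <= rnorm (val z) & rnorm (v z) < eps) ->
  exists2 zeta : C R, rnorm zeta = 1 & forall e : R, 0 < e ->
    exists2 z : disc R, rnorm (val z - zeta) < e & rnorm (v z) < e.
Proof.
move=> small; apply: contrapT => noz.
have /choice[g gP] (a : C R) : exists g : R, 0 < g /\
    [\/ rnorm a <= 1 - 2 * g, 1 + g <= rnorm a |
      forall z : disc R, rnorm (val z - a) < g -> g <= rnorm (v z)].
  have [a1|a1|a1] := ltgtP (rnorm a) 1.
  - exists ((1 - rnorm a) / 2); split; first by rewrite divr_gt0// subr_gt0.
    by constructor 1; lra.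
  - by exists (rnorm a - 1); split; [rewrite subr_gt0|constructor 2; lra].
  have [e e0 eP] : exists2 e : R, 0 < e & forall z : disc R,
      rnorm (val z - a) < e -> e <= rnorm (v z).
    apply: contrapT => noe; apply: noz; exists a => // e e0.
    apply: contrapT => noz; apply: noe; exists e => // z za.
    by rewrite leNgt; apply/negP => ve; apply: noz; exists z.
  by exists e; split=> //; constructor 3.
have g0 a : 0 < g a by have [] := gP a.
have [s sP] := closed_disc_cover g0; have [c c0 cs] := seq_lower_bound s g0.
pose m := Num.min c 1 / 2.
have m01 : 0 < m < 1.
  apply/andP; split; first by rewrite divr_gt0// lt_min c0 ltr01.
  have : Num.min c 1 <= 1 by rewrite ge_min lexx orbT.
  by rewrite /m; lra.
have mc : m < c.
  have : Num.min c 1 <= c by rewrite ge_min lexx.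
  by rewrite /m; lra.
have [|z zm vz] := small (1 - m) c _ c0; first by lra.
have z1 := disc_lt1 z; have [a /cs ca za] := sP (val z) (ltW z1).
have := rnorm_dist (val z) a; have := rnorm_dist a (val z); rewrite rnormB => d1 d2.
have [_ [h|h|/(_ z za)]] := gP a; lra.
Qed.

Lemma not_finite_codim (v : disc R -> C R) : multipliers ev v ->
  (forall r eps : R, 0 < r < 1 -> 0 < eps ->
    exists2 z : disc R, r <= rnorm (val z) & rnorm (v z) < eps) ->
  ~ finite_codim (mult_range v).
Proof.
move=> Mv /boundary_cluster_point[zeta zeta1 near] /(finite_codim_divisible Mv)[K Kdep].
have zneq (z : disc R) : 0 < rnorm (val z - zeta).
  rewrite rnorm_gt0 subr_eq0; apply/eqP => zz.
  by have := disc_lt1 z; rewrite zz zeta1 ltxx.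
have /choice[f fP] (p : nat * disc R) : exists z : disc R,
    100 * rnorm (val z - zeta) <= rnorm (val p.2 - zeta) /\
    rnorm (v z) < p.1.+1%:R^-1.
  have [|z] := near (Num.min (rnorm (val p.2 - zeta) / 100) p.1.+1%:R^-1).
    by rewrite lt_min divr_gt0 ?zneq//= invr_gt0.
  rewrite !lt_min => /andP[zp _] /andP[_ vz]; exists z; split=> //.
  by rewrite ltr_pdivlMr// in zp; rewrite mulrC ltW.
have [z0 _] := near 1 ltr01.
pose fix z_ n : disc R := if n is m.+1 then f (m, z_ m) else z0.
have [|||psi [psiH indep]] := @boundary_independent_functions R zeta zeta1
  (fun n => rnorm (val (z_ n) - zeta)) _ _ K z_.
- by move=> n; exact: zneq.
- by move=> n; have [] := fP (n, z_ n).
- by [].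
have [lambda l0 [q [B [qB vq]]]] := Kdep psi psiH.
have [c c0 cP] := indep lambda l0.
have B0 : 0 <= B by apply: le_trans (rnorm_ge0 _) (qB z0).
(* The bound [|v| < 1 / n.+1] holds at [z_ n.+1], so index 0 is excluded; beyond the threshold
   [B / n.+1 < c]. *)
have [[|n]] := cP (Num.truncn (B / c)).+1; first by [].
rewrite ltnS => Nn; rewrite vq rnormM => cvq.
have [_ vz] := fP (n, z_ n).
have n1 : 0 < n.+1%:R :> R by [].
have Bn : B < c * n.+1%:R.
  rewrite mulrC -ltr_pdivrMr//; apply: lt_le_trans (truncnS_gt _) _.
  by rewrite ler_nat.
have : c <= n.+1%:R^-1 * B.
  by apply: le_trans cvq _; rewrite ler_pM ?rnorm_ge0 ?qB// ltW.
by rewrite mulrC ler_pdivlMr// leNgt Bn.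
Qed.

End FunctionSpace.

Theorem theorem4p5 (R : realType) (X : completeNormedModType (C R))
    (ev : {linear X -> (disc R -> C R)})
    (evX : space_of_analytic_functions ev)
    (const_X : contains_constants ev)
    (cond_I : finer_than_compact_open ev)
    (cond_IV : division_property ev)
    (MX : multipliers ev = Hinfty R)
    (u : disc R -> C R) (Mu : multipliers ev u) :
  essential_spectrum (mult_operator evX Mu) =
  \bigcap_(r in [set r : R | 0 < r < 1])
    closure (u @` [set z : disc R | r%:C%C <= `|val z|]).
Proof.
have rle (r : R) (z : disc R) : (r%:C%C <= `|val z|) = (r <= rnorm (val z)).
  by rewrite -cplx_le -rnormE.
apply/seteqP; split=> [lambda nF r /= r01|lambda lcl F].
  apply: contrapT => ncl; apply: nF.
  have [eps eps0 epsP] : exists2 eps : R, 0 < eps & forall z : disc R,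
      r <= rnorm (val z) -> eps <= rnorm (u z - lambda).
    apply: contrapT => noeps; apply: ncl => B /nbhs_rnormP[e e0 eB].
    apply: contrapT => disj; apply: noeps; exists e => // z zr.
    rewrite leNgt; apply/negP => ue; apply: disj; exists (u z); split.
      by exists z => //; rewrite /= rle.
    exact: eB.
  exact: fredholm_mult_operator r01 eps0 epsP.
have [_ _ _ codim] := F.
have Mv := multiplier_sub_cst evX const_X lambda Mu.
apply: (not_finite_codim evX const_X MX Mv).
  move=> r eps r01 eps0.
  have nb : nbhs lambda [set w : C R | rnorm (w - lambda) < eps].
    by apply/nbhs_rnormP; exists eps.
  have [_ [[z zr <-] uz]] := lcl r r01 _ nb.
  by exists z => //; rewrite -rle.
rewrite (_ : mult_range _ _ = range (mult_operator evX Mu \- lambda \*: idfun))//.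
apply/seteqP; split=> [x [f xE]|_ [f _ <-]].
  by exists f => //; apply: evX.1; rewrite mult_operator_sub_cst.
by exists f; rewrite mult_operator_sub_cst.
Qed.
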